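(* Let $\phi(\vec x)$ be an $\mathcal{L}(U,\Sigma)$-formula. Then $\phi$ is equivalent, provably in $\mathrm{ACF}(\mathfrak{m},\Sigma)$, to a controlled formula.
   Context: $\mathcal{L}=\{0,1,+,-,\cdot\}$ is the language of rings. $\mathcal{L}(U,\Sigma)$ adds a unary predicate $U$ and, for every $n$ and $\vec k\in\mathbb{Z}^n$, an $n$-ary relation symbol $\Sigma_{\vec k}$. A subgroup $G\subseteq K^\times$ of a field $K$ is \emph{small} in $K$ if whenever $f:K^m\to K$ is definable (in the field $K$, parameters allowed), $f(G^m)\subsetneq K$. $\mathrm{ACF}(\mathfrak{m},\Sigma)$ is the theory of structures $(K,G)$, with $U$ interpreted as $G$, stating that $K$ is an algebraically closed field, $G$ is a multiplicative subgroup of $K^\times$ which is small in $K$, and $\forall\vec y\,(\Sigma_{\vec k}(\vec y)\leftrightarrow\bigwedge_{i\le n}Uy_i\wedge k_1y_1+\cdots+k_ny_n=0)$ for every $\vec k$. $\exists^U\vec y\,\phi$ abbreviates $\exists\vec y\,(\bigwedge_i Uy_i\wedge\phi)$ and $\forall^U\vec y\,\phi$ abbreviates $\forall\vec y\,(\bigwedge_i Uy_i\to\phi)$. $\mathcal{L}_{\mathfrak m}(\Sigma)=\{1,\cdot\}\cup\{\Sigma_{\vec k}\}$. The \emph{$U$-formulas} are the smallest class containing the atomic formulas of $\mathcal{L}_{\mathfrak m}(\Sigma)$ and closed under $\neg,\wedge,\vee$, $\exists^Ux$, $\forall^Ux$. A formula $\phi(\vec x;\vec y)$ with the displayed division of variables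 is \emph{split} if it is a Boolean combination of $U$-formulas whose only free variables are among $\vec y$ and $\mathcal{L}$-formulas (which may contain all the variables). (Lists of variables may be empty.) Split formulas $\{\eta^+_j(\vec x;\vec u,\vec y_j)\}_{j\in J}$, $\{\eta^-_j(\vec x;\vec u,\vec y'_j)\}_{j\in J}$ ($J$ finite; $\vec y_j,\vec y'_j$ may have different lengths) form a \emph{partition of cases} if $\mathrm{ACF}(\mathfrak m,\Sigma)$ proves that for every $\vec x,\vec u$ there is exactly one $j$ with $\exists^U\vec y_j\,\eta^+_j\wedge\forall^U\vec y'_j\,\eta^-_j$. A collection $\{\psi_j(\vec x;\vec u,\vec y_j)\}_{j\in J}$ is \emph{rigid} under it if for each $j$, $\mathrm{ACF}(\mathfrak m,\Sigma)$ proves that, whenever $\vec x,\vec u$ are in case $j$ (i.e. $\exists^U\vec y_j\,\eta^+_j\wedge\forall^U\vec y'_j\,\eta^-_j$ holds), for any two tuples $\vec y,\vec y^*$ from $U$ both satisfying $\eta^+_j(\vec x;\vec u,\cdot)$ we have $\psi_j(\vec x;\vec u,\vec y)\leftrightarrow\psi_j(\vec x;\vec u,\vec y^* )$. For a partition of cases and a rigid collection, $$\bigoplus_{j\in J}\eta^\pm_j(\vec x;\vec u,\vec y_j)\to\psi_j(\vec x;\vec u,\vec y_j)$$ abbreviates $\bigvee_{j\in J}\exists^U\vec y_j\,\bigl(\eta^+_j(\vec x;\vec u,\vec y_j)\wedge\forall^U\vec y'_j\,\eta^-_j(\vec x;\vec u,\vec y'_j)\wedge\psi_j(\vec x;\vec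 u,\vec y_j)\bigr)$. A \emph{controlled formula} is a formula of this form in which every $\psi_j$ is a split formula. *)

(* Defs.v *)
From HB Require Import structures.
From mathcomp Require Import all_boot all_order all_algebra.
Set Implicit Arguments.
Unset Strict Implicit.
Unset Printing Implicit Defensive.
Import GRing.Theory.
Local Open Scope ring_scope.

(* Variables are named by natural numbers. *)

Inductive term :=
| Var of nat
| Zero
| One
| Add of term & term
| Opp of term
| Mul of term & term.

Inductive formula :=
| Equal of term & term
| InU of term
| Sigma n of n.-tuple int & n.-tuple term
| Not of formula
| And of formula & formula
| Or of formula & formula
| Implies of formula & formula
| Exists of nat & formula
| Forall of nat & formula.

Definition False_ := Not (Equal Zero Zero).
Definition Iff f g := And (Implies f g) (Implies g f).
Definition exU1 x f := Exists x (And (InU (Var x)) f).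
Definition allU1 x f := Forall x (Implies (InU (Var x)) f).
Definition exU (ys : seq nat) f := foldr exU1 f ys.
Definition allU (ys : seq nat) f := foldr allU1 f ys.

Fixpoint term_vars (t : term) : seq nat :=
  match t with
  | Var v => [:: v]
  | Zero | One => [::]
  | Add s t | Mul s t => term_vars s ++ term_vars t
  | Opp t => term_vars t
  end.

Fixpoint free_vars (f : formula) : seq nat :=
  match f with
  | Equal s t => term_vars s ++ term_vars t
  | InU t => term_vars t
  | Sigma _ _ ts => flatten (map term_vars ts)
  | Not f => free_vars f
  | And f g | Or f g | Implies f g => free_vars f ++ free_vars g
  | Exists x f | Forall x f => [seq v <- free_vars f | v != x]
  end.

Inductive L_formula : formula -> Prop :=
| L_Equal s t : L_formula (Equal s t)
| L_Not f of L_formula f : L_formula (Not f)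
| L_And f g of L_formula f & L_formula g : L_formula (And f g)
| L_Or f g of L_formula f & L_formula g : L_formula (Or f g)
| L_Implies f g of L_formula f & L_formula g : L_formula (Implies f g)
| L_Exists x f of L_formula f : L_formula (Exists x f)
| L_Forall x f of L_formula f : L_formula (Forall x f).

(* Terms of the language {1, *}. *)
Fixpoint mul_term (t : term) : bool :=
  match t with
  | Var _ | One => true
  | Mul s t => mul_term s && mul_term t
  | _ => false
  end.

Inductive U_formula : formula -> Prop :=
| U_Equal s t of mul_term s & mul_term t : U_formula (Equal s t)
| U_Sigma n (k : n.-tuple int) (ts : n.-tuple term) of all mul_term ts :
    U_formula (Sigma k ts)
| U_Not f of U_formula f : U_formula (Not f)
| U_And f g of U_formula f & U_formula g : U_formula (And f g)
| U_Or f g of U_formula f & U_formula g : U_formula (Or f g)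
| U_exU x f of U_formula f : U_formula (exU1 x f)
| U_allU x f of U_formula f : U_formula (allU1 x f).

Inductive split_formula (xs ys : seq nat) : formula -> Prop :=
| split_U f of U_formula f & {subset free_vars f <= ys} :
    split_formula xs ys f
| split_L f of L_formula f & {subset free_vars f <= xs ++ ys} :
    split_formula xs ys f
| split_Not f of split_formula xs ys f : split_formula xs ys (Not f)
| split_And f g of split_formula xs ys f & split_formula xs ys g :
    split_formula xs ys (And f g)
| split_Or f g of split_formula xs ys f & split_formula xs ys g :
    split_formula xs ys (Or f g).

(* The field axioms and algebraic closedness of ACF(m, Sigma) are carried by
   closedFieldType; the remaining axioms are stated in [ACF_m_Sigma]. *)
Record structure := Structure {
  carrier :> closedFieldType;
  U_interp : carrier -> Prop;
  Sigma_interp : forall n, n.-tuple int -> n.-tuple carrier -> Prop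
}.

Definition upd (T : Type) (e : nat -> T) (x : nat) (a : T) : nat -> T :=
  fun v => if v == x then a else e v.

Section Semantics.
Variable M : structure.

Fixpoint eval (e : nat -> M) (t : term) : M :=
  match t with
  | Var v => e v
  | Zero => 0
  | One => 1
  | Add s t => eval e s + eval e t
  | Opp t => - eval e t
  | Mul s t => eval e s * eval e t
  end.

Fixpoint holds (e : nat -> M) (f : formula) : Prop :=
  match f with
  | Equal s t => eval e s = eval e t
  | InU t => U_interp (eval e t)
  | Sigma _ k ts => Sigma_interp k (map_tuple (eval e) ts)
  | Not f => ~ holds e f
  | And f g => holds e f /\ holds e g
  | Or f g => holds e f \/ holds e g
  | Implies f g => holds e f -> holds e g
  | Exists x f => exists a, holds (upd e x a) f
  | Forall x f => forall a, holds (upd e x a) f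
  end.

(* The graph of h is defined by F in the variables 0, ..., m - 1 (arguments)
   and m (value); e provides the parameters, as values of the variables > m. *)
Definition definable m (h : m.-tuple M -> M) : Prop :=
  exists (F : formula) (e : nat -> M), L_formula F /\
    forall (a : m.-tuple M) (b : M),
      holds (fun v => nth (e v) (rcons a b) v) F <-> h a = b.

Definition mul_subgroup (G : M -> Prop) : Prop :=
  [/\ forall a, G a -> a != 0,
      G 1,
      forall a b, G a -> G b -> G (a * b)
    & forall a, G a -> G a^-1].

Definition small (G : M -> Prop) : Prop :=
  forall m (h : m.-tuple M -> M), definable h ->
    exists b, forall a : m.-tuple M, (forall i, G (tnth a i)) -> h a <> b.

Definition Sigma_axioms : Prop :=
  forall n (k : n.-tuple int) (a : n.-tuple M),
    Sigma_interp k a <->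
    (forall i, U_interp (tnth a i)) /\ \sum_(i < n) tnth a i *~ tnth k i = 0.

Definition ACF_m_Sigma : Prop :=
  [/\ mul_subgroup (@U_interp M), small (@U_interp M) & Sigma_axioms].

(* e' changes the values of the variables ys in e to elements of U. *)
Definition U_variant (ys : seq nat) (e e' : nat -> M) : Prop :=
  (forall v, v \notin ys -> e' v = e v) /\
  (forall v, v \in ys -> U_interp (e' v)).

End Semantics.

(* Provability is rendered as truth in all models under all assignments. *)
Definition ACF_proves (f : formula) : Prop :=
  forall M : structure, ACF_m_Sigma M -> forall e : nat -> M, holds e f.

Definition in_case (ys ys' : seq nat) (etap etan : formula) : formula :=
  And (exU ys etap) (allU ys' etan).

Definition partition_of_cases (xs us : seq nat) (J : finType)
    (ys ys' : J -> seq nat) (etap etan : J -> formula) : Prop :=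
  (forall j, [/\ uniq (xs ++ us ++ ys j), uniq (xs ++ us ++ ys' j),
     split_formula xs (us ++ ys j) (etap j)
   & split_formula xs (us ++ ys' j) (etan j)]) /\
  (forall M : structure, ACF_m_Sigma M -> forall e : nat -> M,
     exists! j, holds e (in_case (ys j) (ys' j) (etap j) (etan j))).

Definition rigid (J : finType) (ys ys' : J -> seq nat)
    (etap etan psi : J -> formula) : Prop :=
  forall j (M : structure), ACF_m_Sigma M -> forall e : nat -> M,
    holds e (in_case (ys j) (ys' j) (etap j) (etan j)) ->
  forall e1 e2 : nat -> M,
    U_variant (ys j) e e1 -> U_variant (ys j) e e2 ->
    holds e1 (etap j) -> holds e2 (etap j) ->
    (holds e1 (psi j) <-> holds e2 (psi j)).

Definition oplus (J : finType) (ys ys' : J -> seq nat)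
    (etap etan psi : J -> formula) : formula :=
  \big[Or/False_]_(j : J)
    exU (ys j) (And (etap j) (And (allU (ys' j) (etan j)) (psi j))).

Definition controlled (xs us : seq nat) (theta : formula) : Prop :=
  exists (J : finType) (ys ys' : J -> seq nat)
    (etap etan psi : J -> formula),
  [/\ partition_of_cases xs us ys ys' etap etan,
      forall j, split_formula xs (us ++ ys j) (psi j),
      rigid ys ys' etap etan psi
    & theta = oplus ys ys' etap etan psi].

(* Main.v *)
Require Import Defs.
From mathcomp Require Import all_boot all_order all_algebra.
From mathcomp Require Import ring zify.
From Stdlib Require Import Classical FunctionalExtensionality.
Set Implicit Arguments.
Unset Strict Implicit.
Unset Printing Implicit Defensive.
Import GRing.Theory.
Local Open Scope ring_scope.

(* Every formula is first reduced to one whose quantifiers all range over U. To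
   eliminate a quantifier over z in K, split according to whether z is generic, i.e.
   a root of p(x, y, Z), for a polynomial p occurring in the formula and y in U, only
   when this polynomial in Z vanishes identically. For generic z every equation
   p(x, y, z) = 0 is a system of equations on x, y, and a generic z exists by
   smallness. A nongeneric z belongs to one of finitely many finite sets given by
   some y in U, and a quantifier over a finite set of bounded size commutes with the
   quantifiers over U, so it can be pushed inwards to the quantifier-free part and
   eliminated in K.

   A polynomial equation sum_mu c_mu(x) y^mu = 0 defines on U the set of y whose
   vector of monomials depends linearly on those of a maximal independent family
   h of solutions. The size d of h gives the partition of cases, and for any
   choice of h the formula becomes a U-formula in h, whence rigidity. *)

(** * Quantifier elimination for algebraically closed fields *)

(** Smallness speaks of single-valued definable functions on powers of U, whereas nongeneric
    elements come in finite sets depending on a tuple from U, and a point of such a set need not be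
    definable from the tuple. The bridge is that no definable family of sets of bounded size indexed
    by a power of U covers K: from a bound d + 2 on the sizes one passes to d + 1, and at bound 1
    the family is essentially a function. In the second half, linear dependence is taken over K,
    since the coefficients of the equation lie in K. This brings back a quantifier over K, but one
    that ranges over no variable of the formula: field elimination turns it into polynomial
    conditions with integer coefficients on elements of U, which the relations Sigma express.
    Moreover the case and the family h depend on x alone, so quantifiers over U leave them
    untouched. *)

(* Variables are drawn from an arbitrary type: quantifying over one variable leads
   from [option V] to [V], quantifying over a block J from [J + Y] to [Y]. *)
Inductive tm (V : Type) : Type :=
| TVar of V
| TZero
| TOne
| TAdd of tm V & tm V
| TOpp of tm V
| TMul of tm V & tm V.
Arguments TZero {V}.
Arguments TOne {V}.

Fixpoint teval (R : nzRingType) V (e : V -> R) (t : tm V) : R :=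
  match t with
  | TVar v => e v
  | TZero => 0
  | TOne => 1
  | TAdd s t => teval e s + teval e t
  | TOpp t => - teval e t
  | TMul s t => teval e s * teval e t
  end.

Fixpoint tsub V W (s : V -> tm W) (t : tm V) : tm W :=
  match t with
  | TVar v => s v
  | TZero => TZero
  | TOne => TOne
  | TAdd t u => TAdd (tsub s t) (tsub s u)
  | TOpp t => TOpp (tsub s t)
  | TMul t u => TMul (tsub s t) (tsub s u)
  end.

Lemma teval_tsub (R : nzRingType) V W (s : V -> tm W) (e : W -> R) t :
  teval e (tsub s t) = teval (fun v => teval e (s v)) t.
Proof. by elim: t => //= [t -> u ->|t ->|t -> u ->]. Qed.

Inductive qf (V : Type) : Type :=
| QEq of tm V
| QNot of qf V
| QAnd of qf V & qf V.

Fixpoint qsat (K : closedFieldType) V (e : V -> K) (f : qf V) : bool :=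
  match f with
  | QEq t => teval e t == 0
  | QNot f => ~~ qsat e f
  | QAnd f g => qsat e f && qsat e g
  end.

Fixpoint qsub V W (s : V -> tm W) (f : qf V) : qf W :=
  match f with
  | QEq t => QEq (tsub s t)
  | QNot f => QNot (qsub s f)
  | QAnd f g => QAnd (qsub s f) (qsub s g)
  end.

Lemma qsat_qsub (K : closedFieldType) V W (s : V -> tm W) (e : W -> K) f :
  qsat e (qsub s f) = qsat (fun v => teval e (s v)) f.
Proof. by elim: f => //= [t|f ->|f -> g ->] //; rewrite teval_tsub. Qed.

Definition ocons (K V : Type) (a : K) (e : V -> K) (v : option V) : K :=
  if v is Some v then e v else a.

(** The formula is chosen before the field, so that one formula serves all models in every
    characteristic. Keeping [P] semantic lets closure lemmas replace syntactic constructions. *)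
Definition qdef V (P : forall K : closedFieldType, (V -> K) -> Prop) :=
  exists f : qf V, forall (K : closedFieldType) (e : V -> K), qsat e f <-> P K e.

Section QdefClosure.
Variable V : Type.
Implicit Types P Q : forall K : closedFieldType, (V -> K) -> Prop.

Lemma qdef_qf (f : qf V) : qdef (fun K e => @qsat K V e f).
Proof. by exists f. Qed.

Lemma qdef_ext P Q : (forall K e, P K e <-> Q K e) -> qdef P -> qdef Q.
Proof. by move=> PQ [f fP]; exists f => K e; rewrite fP. Qed.

Lemma qdef_eq0 (t : tm V) : qdef (fun (K : closedFieldType) (e : V -> K) => teval e t = 0).
Proof. by exists (QEq t) => K e; split=> /eqP. Qed.

Lemma qdef_not P : qdef P -> qdef (fun K e => ~ P K e).
Proof. by case=> f fP; exists (QNot f) => K e /=; rewrite -fP; split=> /negP. Qed.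

Lemma qdef_and P Q : qdef P -> qdef Q -> qdef (fun K e => P K e /\ Q K e).
Proof.
move=> [f fP] [g gQ]; exists (QAnd f g) => K e /=.
by rewrite -fP -gQ; split=> /andP.
Qed.

Lemma qdef_or P Q : qdef P -> qdef Q -> qdef (fun K e => P K e \/ Q K e).
Proof.
move=> dP dQ; apply: qdef_ext (qdef_not (qdef_and (qdef_not dP) (qdef_not dQ))).
by move=> K e; split=> ?; tauto.
Qed.

Lemma qdef_imp P Q : qdef P -> qdef Q -> qdef (fun K e => P K e -> Q K e).
Proof.
move=> dP dQ; apply: qdef_ext (qdef_not (qdef_and dP (qdef_not dQ))).
by move=> K e; split=> ?; tauto.
Qed.

Lemma qdef_true : qdef (fun (K : closedFieldType) (_ : V -> K) => True).
Proof. by exists (QEq TZero) => K e /=; rewrite eqxx. Qed.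

Lemma qdef_false : qdef (fun (K : closedFieldType) (_ : V -> K) => False).
Proof. by apply: qdef_ext (qdef_not qdef_true) => K e; tauto. Qed.

Lemma qdef_all (T : eqType) (s : seq T)
    (P : T -> forall K : closedFieldType, (V -> K) -> Prop) :
  (forall i, qdef (P i)) -> qdef (fun K e => forall i, i \in s -> P i K e).
Proof.
move=> dP; elim: s => [|i s IH]; first by apply: qdef_ext qdef_true.
apply: qdef_ext (qdef_and (dP i) IH) => K e; split=> [[Pi Ps] j|Ps].
  by rewrite inE => /orP[/eqP ->|/Ps].
by split=> [|j js]; apply: Ps; rewrite inE ?eqxx ?js ?orbT.
Qed.

Lemma qdef_forall_fin (T : finType)
    (P : T -> forall K : closedFieldType, (V -> K) -> Prop) :
  (forall i, qdef (P i)) -> qdef (fun K e => forall i, P i K e).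
Proof.
move=> /(qdef_all (enum T)); apply: qdef_ext => K e.
by split=> H i; [apply: H; rewrite mem_enum|move=> _].
Qed.

End QdefClosure.

Lemma qdef_sub V W (s : V -> tm W)
    (P : forall K : closedFieldType, (V -> K) -> Prop) :
  qdef P -> qdef (fun K e => P K (fun v => teval e (s v))).
Proof. by case=> f fP; exists (qsub s f) => K e; rewrite qsat_qsub fP. Qed.

Lemma qdef_ren V W (s : V -> W)
    (P : forall K : closedFieldType, (V -> K) -> Prop) :
  qdef P -> qdef (fun K e => P K (e \o s)).
Proof. exact: (qdef_sub (fun v => TVar (s v))). Qed.

(* Polynomials in one variable with coefficients in [tm V] are represented by
    the list of their coefficients, lowest degree first. *)
Section TermPoly.
Variable V : Type.
Implicit Types p q r : seq (tm V).

Definition peval (R : nzRingType) (e : V -> R) p : {poly R} :=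
  Poly (map (teval e) p).

Fixpoint padd p q :=
  match p, q with
  | [::], _ => q
  | _, [::] => p
  | c :: p, d :: q => TAdd c d :: padd p q
  end.

Fixpoint pmul p q :=
  if p is c :: p then padd (map (TMul c) q) (TZero :: pmul p q) else [::].

Definition pexp p n := iter n (pmul p) [:: TOne].

Lemma size_padd p q : size (padd p q) = maxn (size p) (size q).
Proof.
elim: p q => [|c p IH] [|d q] //=.
by rewrite IH maxnSS.
Qed.

Section Peval.
Variables (K : closedFieldType) (e : V -> K).

Lemma peval_cons c p : peval e (c :: p) = (teval e c)%:P + 'X * peval e p.
Proof. by rewrite /peval /= cons_poly_def commr_polyX addrC. Qed.

Lemma peval_add p q : peval e (padd p q) = peval e p + peval e q.
Proof.
elim: p q => [|c p IH] [|d q]; rewrite /= ?[peval e [::]]/peval /= ?add0r ?addr0 //.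
by rewrite !peval_cons IH /= polyCD; ring.
Qed.

Lemma peval_scale c p : peval e (map (TMul c) p) = teval e c *: peval e p.
Proof.
elim: p => [|d p IH]; first by rewrite /peval scaler0.
by rewrite /= !peval_cons IH /= -!mul_polyC polyCM; ring.
Qed.

Lemma peval_mul p q : peval e (pmul p q) = peval e p * peval e q.
Proof.
elim: p => [|c p IH]; first by rewrite /peval mul0r.
by rewrite /= peval_add peval_cons IH peval_scale peval_cons -mul_polyC polyC0; ring.
Qed.

Lemma peval_exp p n : peval e (pexp p n) = peval e p ^+ n.
Proof.
elim: n => [|n IH]; last by rewrite /= peval_mul IH exprS.
by rewrite /= peval_cons /peval /= mulr0 addr0.
Qed.

Lemma peval_rcons p c :
  peval e (rcons p c) = peval e p + teval e c *: 'X^(size p).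
Proof.
elim: p => [|d p IH].
  by rewrite /= peval_cons /peval /= expr0 mulr0 addr0 add0r alg_polyC.
by rewrite /= !peval_cons IH exprS -!mul_polyC; ring.
Qed.

Lemma peval_shift p n : peval e (nseq n TZero ++ p) = 'X^n * peval e p.
Proof.
elim: n => [|n IH]; first by rewrite expr0 mul1r.
by rewrite /= peval_cons IH exprS /= polyC0 add0r mulrA.
Qed.

Lemma size_peval p : (size (peval e p) <= size p)%N.
Proof. by rewrite /peval; apply: leq_trans (size_Poly _) _; rewrite size_map. Qed.

Lemma size_peval_rcons p c :
  teval e c != 0 -> size (peval e (rcons p c)) = (size p).+1.
Proof.
move=> c0; rewrite peval_rcons addrC size_polyDl ?size_scale ?size_polyXn //.
exact: leq_ltn_trans (size_peval _) _.
Qed.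

Lemma peval_eq0 p : peval e p = 0 <-> forall i : 'I_(size p), teval e (nth TZero p i) = 0.
Proof.
split=> [p0 i|p0].
  by rewrite -(nth_map _ 0) // -coef_Poly -/(peval e p) p0 coef0.
apply/polyP=> i; rewrite coef0 coef_Poly.
case: (ltnP i (size p)) => ip; last by rewrite nth_default ?size_map.
by rewrite (nth_map TZero) // (p0 (Ordinal ip)).
Qed.

End Peval.

Lemma qdef_peval_eq0 p : qdef (fun K e => @peval K e p = 0).
Proof.
have dP := qdef_forall_fin (fun i : 'I_(size p) => qdef_eq0 (nth TZero p i)).
apply: qdef_ext dP => K e.
by rewrite peval_eq0.
Qed.

(** Terms cannot be divided, so each division step multiplies by [l]: with [c] the top coefficient
    split off from [r], the difference l r - c X^m p has lost the top degree. The remainder is the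
    same whether or not [l] vanishes in a given field. *)
Lemma pseudo_rem p l r : exists2 r' : seq (tm V), (size r' <= size p)%N &
  forall (K : closedFieldType) (e : V -> K), exists k (q : {poly K}),
    teval e l ^+ k *: peval e r = peval e (rcons p l) * q + peval e r'.
Proof.
have [n] := ubnP (size r); elim: n r => // n IH r lt_r_n.
case: (leqP (size r) (size p)) => [r_p|].
  by exists r => // K e; exists 0%N, 0; rewrite expr0 scale1r mulr0 add0r.
case/lastP: r lt_r_n => [//|r c]; rewrite size_rcons !ltnS => lt_r_n le_p_r.
pose m := (size r - size p)%N.
pose r1 := padd (map (TMul l) r) (nseq m TZero ++ map (TMul (TOpp c)) p).
have size_r1 : size r1 = size r.
  by rewrite size_padd size_cat size_nseq !size_map subnK ?maxnn.
case: (IH r1) => [|r' r'_p div_r']; first by rewrite size_r1.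
exists r' => // K e; case: (div_r' K e) => k [q def_q].
exists k.+1, ((teval e l ^+ k * teval e c) *: 'X^m + q).
rewrite exprSr -scalerA.
have -> : teval e l *: peval e (rcons r c) =
    teval e c *: ('X^m * peval e (rcons p l)) + peval e r1.
  rewrite peval_add peval_shift !peval_scale !peval_rcons /= -!mul_polyC polyCN.
  have -> : 'X^(size r) = 'X^m * 'X^(size p) :> {poly K} by rewrite -exprD subnK.
  by ring.
by rewrite scalerDr def_q -!mul_polyC polyCM; ring.
Qed.

End TermPoly.

Section TermInLastVariable.
Variable V : Type.

Fixpoint tpoly (t : tm (option V)) : seq (tm V) :=
  match t with
  | TVar None => [:: TZero; TOne]
  | TVar (Some v) => [:: TVar v]
  | TZero => [::]
  | TOne => [:: TOne]
  | TAdd s t => padd (tpoly s) (tpoly t)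
  | TOpp t => map (TMul (TOpp TOne)) (tpoly t)
  | TMul s t => pmul (tpoly s) (tpoly t)
  end.

Lemma horner_tpoly (K : closedFieldType) (e : V -> K) a t :
  (peval e (tpoly t)).[a] = teval (ocons a e) t.
Proof.
elim: t => [[v|]|||s IHs t IHt|t IHt|s IHs t IHt] /=.
- by rewrite /peval /= cons_poly_def !hornerE.
- by rewrite /peval /= !cons_poly_def !hornerE.
- by rewrite /peval hornerE.
- by rewrite /peval /= cons_poly_def !hornerE.
- by rewrite peval_add hornerD IHs IHt.
- by rewrite peval_scale hornerZ IHt /= mulN1r.
- by rewrite peval_mul hornerM IHs IHt.
Qed.

End TermInLastVariable.

(** No root of [p] has multiplicity above [n], so the n-th power of [r] absorbs all linear factors
    of [p]. Unlike a statement on roots, divisibility can be read off a remainder. *)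
Lemma all_root_dvdp_exp (K : closedFieldType) (p r : {poly K}) n :
    p != 0 -> (size p <= n.+1)%N ->
  (forall a, root p a -> root r a) <-> p %| r ^+ n.
Proof.
move=> p0 le_p_n; split=> [roots_r|dvd_p a pa0].
  have [s def_p] := closed_field_poly_normal p.
  have size_s : (size s <= n)%N.
    by move: le_p_n; rewrite def_p size_scale ?lead_coef_eq0 // size_prod_XsubC.
  have roots_s a : a \in s -> root r a.
    move=> a_s; apply: roots_r; rewrite def_p rootZ ?lead_coef_eq0 //.
    by rewrite root_prod_XsubC.
  rewrite def_p dvdpZl ?lead_coef_eq0 // -(subnK size_s) exprD dvdp_mull //.
  elim: s {def_p size_s} roots_s => [|a s IH] roots_s; first by rewrite big_nil expr0.
  rewrite big_cons exprS dvdp_mul ?dvdp_XsubCl ?roots_s ?mem_head ?IH // => b bs.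
  by rewrite roots_s // inE bs orbT.
have: root (r ^+ n) a.
  by rewrite -dvdp_XsubCl; apply: dvdp_trans dvd_p; rewrite dvdp_XsubCl.
by rewrite !rootE horner_exp expf_eq0 => /andP[].
Qed.

Section Elimination.
Variable V : Type.
Implicit Types (p r : seq (tm V)) (ps : seq (seq (tm V))).

Definition common_root (K : closedFieldType) (e : V -> K) ps r :=
  exists a, all (fun p => root (peval e p) a) ps && ~~ root (peval e r) a.

Lemma common_root_lead0 (K : closedFieldType) (e : V -> K) p l ps r :
  teval e l = 0 -> common_root e (rcons p l :: ps) r <-> common_root e (p :: ps) r.
Proof.
by move=> l0; rewrite /common_root /= peval_rcons l0 scale0r addr0.
Qed.

Lemma common_root_nil (K : closedFieldType) (e : V -> K) ps r :
  common_root e ([::] :: ps) r <-> common_root e ps r.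
Proof.
rewrite /common_root /=; have -> : peval e [::] = 0 by [].
by split=> -[a aP]; exists a; move: aP; rewrite root0.
Qed.

Lemma common_root_swap (K : closedFieldType) (e : V -> K) p q ps r :
  common_root e (p :: q :: ps) r <-> common_root e (q :: p :: ps) r.
Proof. by split=> -[a aP]; exists a; move: aP; rewrite /= andbCA. Qed.

Lemma common_root_rem (K : closedFieldType) (e : V -> K) p l q q' ps r k s :
    teval e l != 0 ->
    teval e l ^+ k *: peval e q = peval e (rcons p l) * s + peval e q' ->
  common_root e (rcons p l :: q :: ps) r <-> common_root e (rcons p l :: q' :: ps) r.
Proof.
move=> l0 def_q'.
suff E a : root (peval e (rcons p l)) a ->
    root (peval e q) a = root (peval e q') a.
  split=> -[a /andP[/= /and3P[pa qa psa] ra]]; exists a; rewrite /= pa psa ra.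
    by rewrite -E ?qa.
  by rewrite E ?qa.
move=> /eqP pa; rewrite -(rootZ _ _ (expf_neq0 k l0)) def_q'.
by rewrite !rootE !hornerE pa mul0r add0r.
Qed.

(** The exponent [size p] is the degree of [rcons p l], as [all_root_dvdp_exp] requires; since [r']
    is shorter than the divisor, divisibility amounts to [r'] vanishing. *)
Lemma common_root1 (K : closedFieldType) (e : V -> K) p l r r' k s :
    teval e l != 0 -> (size r' <= size p)%N ->
    teval e l ^+ k *: peval e (pexp r (size p)) =
      peval e (rcons p l) * s + peval e r' ->
  common_root e [:: rcons p l] r <-> peval e r' <> 0.
Proof.
move=> l0 r'p def_r'; pose P := peval e (rcons p l).
have sizeP : size P = (size p).+1 by apply: size_peval_rcons.
have P0 : P != 0 by rewrite -size_poly_gt0 sizeP.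
have dvdP : P %| peval e r ^+ size p <-> peval e r' = 0.
  rewrite -peval_exp -(dvdpZr _ _ (expf_neq0 k l0)) def_r' dvdp_addr ?dvdp_mulr //.
  split=> [dvd_r'|->]; last exact: dvdp0.
  apply/eqP; apply: contraTT dvd_r' => r'0; apply/negP=> /(dvdp_leq r'0).
  by rewrite sizeP ltnNge (leq_trans (size_peval _ _)).
rewrite -dvdP -all_root_dvdp_exp ?sizeP //; split=> [[a]|nroots].
  by rewrite /= andbT => /andP[Pa /negP ra] roots; apply: ra; apply: roots.
apply: NNPP => none; apply: nroots => a Pa; apply/negPn/negP => ra.
by apply: none; exists a; rewrite /= Pa.
Qed.

(** Euclid's algorithm, branching on whether a formal leading coefficient vanishes: it is then
    dropped, and otherwise serves to reduce another polynomial, until at most one is left. Each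
    polynomial counts for one more than its size, so that discarding an empty one decreases the
    measure. *)
Lemma qdef_common_root ps r : qdef (fun K e => @common_root K e ps r).
Proof.
have [n] := ubnP (sumn [seq (size p).+1 | p <- ps]); elim: n ps => // n IH ps.
have step p q qs : (size p <= size q)%N ->
    (sumn [seq (size p).+1 | p <- p :: q :: qs] < n.+1)%N ->
    qdef (fun K e => @common_root K e (p :: q :: qs) r).
  case/lastP: p => [|p l]; rewrite ?size_rcons => le_pq /= lt_n.
    apply: qdef_ext (IH (q :: qs) _) => [K e|]; first by rewrite common_root_nil.
    by rewrite /=; lia.
  have [q' q'p rem_q] := pseudo_rem p l q.
  have d1 : qdef (fun K e => @common_root K e (p :: q :: qs) r).
    by apply: IH; rewrite /=; move: lt_n; rewrite size_rcons; lia.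
  have d2 : qdef (fun K e => @common_root K e (rcons p l :: q' :: qs) r).
    by apply: IH; rewrite /=; move: lt_n; rewrite size_rcons; lia.
  have dl := qdef_eq0 l.
  apply: qdef_ext (qdef_or (qdef_and dl d1) (qdef_and (qdef_not dl) d2)) => K e.
  have [k [s def_q]] := rem_q K e.
  have [l0|/eqP l0] := eqVneq (teval e l) 0.
    by have := common_root_lead0 p (q :: qs) r l0; tauto.
  by have := common_root_rem qs r (introN eqP l0) def_q; tauto.
case: ps => [|p [|q qs]] lt_n.
- apply: qdef_ext (qdef_not (qdef_peval_eq0 r)) => K e.
  split=> [/eqP/closed_nonrootP[a ra]|[a /= ra]]; first by exists a.
  by apply/eqP/closed_nonrootP; exists a.
- case/lastP: p lt_n => [|p l] lt_n.
    apply: qdef_ext (IH [::] _) => [K e|//]; first by rewrite common_root_nil.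
  have [r' r'p rem_r] := pseudo_rem p l (pexp r (size p)).
  have d1 : qdef (fun K e => @common_root K e [:: p] r).
    by apply: IH; move: lt_n; rewrite /= size_rcons; lia.
  have dl := qdef_eq0 l; have dr := qdef_not (qdef_peval_eq0 r').
  apply: qdef_ext (qdef_or (qdef_and dl d1) (qdef_and (qdef_not dl) dr)) => K e.
  have [k [s def_r']] := rem_r K e.
  have [l0|/eqP l0] := eqVneq (teval e l) 0.
    by have := common_root_lead0 p [::] r l0; tauto.
  by have := common_root1 (introN eqP l0) r'p def_r'; tauto.
- case: (leqP (size p) (size q)) => [|/ltnW] le_pq; first exact: step.
  apply: qdef_ext (step q p qs le_pq _) => [K e|]; first by rewrite common_root_swap.
  by move: lt_n; rewrite /=; lia.
Qed.

Definition sys_sat (K : closedFieldType) (e : V -> K)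
    (c : seq (tm V) * tm V) : bool :=
  all (fun t => teval e t == 0) c.1 && (teval e c.2 != 0).

(** The boolean [b] treats a formula and its negation in one induction. One disequation per system
    is enough because several merge into their product. *)
Lemma qf_dnf (f : qf V) (b : bool) :
  exists cs : seq (seq (tm V) * tm V), forall (K : closedFieldType) (e : V -> K),
    (qsat e f == b) = has (sys_sat e) cs.
Proof.
have sys_and (c d : seq (tm V) * tm V) (K : closedFieldType) (e : V -> K) :
    sys_sat e (c.1 ++ d.1, TMul c.2 d.2) = sys_sat e c && sys_sat e d.
  by rewrite /sys_sat /= all_cat mulf_eq0 negb_or andbACA.
have dnf_and (cs ds : seq (seq (tm V) * tm V)) :
    exists es, forall (K : closedFieldType) (e : V -> K),
      has (sys_sat e) cs && has (sys_sat e) ds = has (sys_sat e) es.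
  elim: cs => [|c cs [es IH]]; first by exists [::].
  exists ([seq (c.1 ++ d.1, TMul c.2 d.2) | d <- ds] ++ es) => K e.
  rewrite has_cat -IH has_map.
  have -> : has (preim (fun d => (c.1 ++ d.1, TMul c.2 d.2)) (sys_sat e)) ds =
      sys_sat e c && has (sys_sat e) ds.
    elim: ds {IH} => [|d ds IHd]; first by rewrite andbF.
    by rewrite [LHS]/= IHd [has _ (d :: ds)]/= andb_orr -sys_and.
  by rewrite [has _ (c :: cs)]/= andb_orl.
elim: f b => [t|f IH|f IHf g IHg] b.
- case: b; [exists [:: ([:: t], TOne)]|exists [:: ([::], t)]] => K e /=.
    by rewrite /sys_sat /= oner_eq0 andbT orbF andbT eqb_id.
  by rewrite /sys_sat /= orbF eqbF_neg.
- by have [cs csP] := IH (~~ b); exists cs => K e; rewrite -csP /=; case: (b) (qsat e f) => -[].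
- have [cs csP] := IHf b; have [ds dsP] := IHg b.
  case: b csP dsP => csP dsP.
    have [es esP] := dnf_and cs ds; exists es => K e.
    by rewrite -esP -csP -dsP !eqb_id.
  exists (cs ++ ds) => K e; rewrite has_cat -csP -dsP /= !eqbF_neg.
  by rewrite negb_and.
Qed.

End Elimination.

Lemma qdef_ex V (P : forall K : closedFieldType, (option V -> K) -> Prop) :
  qdef P -> qdef (fun K e => exists a, P K (ocons a e)).
Proof.
case=> f fP; have [cs csP] := qf_dnf f true.
suff dcs : qdef (fun K (e : V -> K) => exists a, has (sys_sat (ocons a e)) cs).
  apply: qdef_ext dcs => K e.
  by split=> -[a aP]; exists a; move: aP; rewrite -fP -csP eqb_id.
elim: cs {csP} => [|c cs IH].
  by apply: qdef_ext (qdef_false V) => K e; split=> // -[].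
have dc := qdef_common_root (map (@tpoly V) c.1) (tpoly c.2).
apply: qdef_ext (qdef_or dc IH) => K e /=.
have cE a : all (fun p => root (peval e p) a) (map (@tpoly V) c.1)
      && ~~ root (peval e (tpoly c.2)) a = sys_sat (ocons a e) c.
  rewrite /sys_sat all_map rootE horner_tpoly; congr (_ && _).
  by apply: eq_all => t /=; rewrite rootE horner_tpoly.
split=> [[|] [a aP]|[a /orP[ca|csa]]].
- by exists a; rewrite -cE aP.
- by exists a; rewrite aP orbT.
- by left; exists a; rewrite cE.
- by right; exists a.
Qed.

Lemma qdef_all_elt V (P : forall K : closedFieldType, (option V -> K) -> Prop) :
  qdef P -> qdef (fun K e => forall a, P K (ocons a e)).
Proof.
move=> /qdef_not/qdef_ex/qdef_not; apply: qdef_ext => K e.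
by split=> [none a|all_P [a]//]; apply: NNPP => nPa; apply: none; exists a.
Qed.

(** * Naming the variables of quantifier-free formulas *)

Fixpoint to_term V (s : V -> term) (t : tm V) : term :=
  match t with
  | TVar v => s v
  | TZero => Zero
  | TOne => One
  | TAdd t u => Add (to_term s t) (to_term s u)
  | TOpp t => Opp (to_term s t)
  | TMul t u => Mul (to_term s t) (to_term s u)
  end.

Fixpoint qf_formula V (s : V -> term) (f : qf V) : formula :=
  match f with
  | QEq t => Equal (to_term s t) Zero
  | QNot f => Not (qf_formula s f)
  | QAnd f g => And (qf_formula s f) (qf_formula s g)
  end.

Section QfFormula.
Variables (V : Type) (s : V -> term).

Lemma eval_to_term (M : structure) (e : nat -> M) t :
  eval e (to_term s t) = teval (fun v => eval e (s v)) t.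
Proof. by elim: t => //= [t -> u ->|t ->|t -> u ->]. Qed.

Lemma holds_qf_formula (M : structure) (e : nat -> M) f :
  holds e (qf_formula s f) <-> qsat (fun v => eval e (s v)) f.
Proof.
elim: f => /= [t|f IH|f IHf g IHg].
- by rewrite eval_to_term; split=> /eqP.
- by rewrite IH; split=> /negP.
- by rewrite IHf IHg; split=> /andP.
Qed.

Lemma L_qf_formula f : L_formula (qf_formula s f).
Proof. by elim: f => *; constructor. Qed.

Lemma free_vars_qf_formula (vs : seq nat) f :
    (forall v, {subset term_vars (s v) <= vs}) ->
  {subset free_vars (qf_formula s f) <= vs}.
Proof.
move=> s_vs.
have t_vs t : {subset term_vars (to_term s t) <= vs}.
  elim: t => //= [t IHt u IHu|t IHt u IHu] x; rewrite mem_cat;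
    by case/orP=> [/IHt|/IHu].
elim: f => //= [t|f IHf g IHg] x; rewrite mem_cat; case/orP=> //.
- exact: t_vs.
- exact: IHf.
- exact: IHg.
Qed.

End QfFormula.

(** * Finite-valued definable families over a small group *)

Definition bcat (K A B : Type) (f : A -> K) (g : B -> K) (v : A + B) : K :=
  match v with inl a => f a | inr b => g b end.

Definition inU_all (M : structure) (I : Type) (h : I -> M) :=
  forall i, U_interp (h i).

Lemma inU_bcat (M : structure) (A B : Type) (f : A -> M) (g : B -> M) :
  inU_all f -> inU_all g -> inU_all (bcat f g).
Proof. by move=> fU gU []. Qed.

(** The multivalued counterpart of a definable map from a power of U onto K. The parameters [w] are
    indexed by a countable type so that they can be named by the variables that [definable] reserves
    for parameters. *)
Definition covered (M : structure) (d : nat) : Prop :=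
  exists (J : finType) (W : countType) (R : qf (option (J + W))) (w : W -> M),
    (forall h : J -> M, inU_all h -> exists2 s : seq M, (size s <= d)%N &
       forall a, qsat (ocons a (bcat h w)) R -> a \in s) /\
    (forall a, exists2 h : J -> M, inU_all h & qsat (ocons a (bcat h w)) R).

(** Off U a fibre may be large, so the function takes the only point of the fibre when there is
    exactly one, and 0 otherwise. It is total and definable, and its values on U already exhaust
    K. *)
Lemma not_covered1 (M : structure) : ACF_m_Sigma M -> ~ covered M 1.
Proof.
move=> [_ smallU _] [J [W [R [w [fibR covR]]]]].
pose m := #|J|.
pose only a h := qsat (ocons a (bcat h w)) R /\
  forall b, qsat (ocons b (bcat h w)) R -> b = a.
have [f fP] : exists f, forall h a, qsat (ocons a (bcat h w)) f <->
    only a h \/ (a = 0 /\ ~ exists b, only b h).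
  have dR (V : Type) (s : option (J + W) -> V) := qdef_ren s (qdef_qf R).
  have d1 := qdef_and (dR _ id) (qdef_all_elt (qdef_imp (dR _ (omap Some))
    (qdef_eq0 (TAdd (TVar None) (TOpp (TVar (Some None))))))).
  have d2 := qdef_not (qdef_ex (qdef_ren (omap Some) d1)).
  have [f fP] := qdef_or d1 (qdef_and (qdef_eq0 (TVar None)) d2).
  have renE (e : option (J + W) -> M) b :
      ocons b e \o omap Some = ocons b (fun v => e (Some v)).
    by apply: functional_extensionality => -[].
  have onlyE h a e : (forall v, e (Some v) = bcat h w v) -> e None = a ->
      (qsat (e \o id) R /\ forall b, qsat (ocons b e \o omap Some) R ->
        b - e None = 0) <-> only a h.
    move=> eh ea; have eE : e = ocons a (bcat h w).
      by apply: functional_extensionality => -[].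
    rewrite /only {}eE; split=> -[Ra Rb]; split=> // b.
      move=> Rb'; apply/eqP; rewrite -subr_eq0; apply/eqP; apply: Rb.
      by rewrite renE.
    by rewrite renE => /Rb ->; rewrite /= subrr.
  exists f => h a; rewrite fP; have := onlyE h a (ocons a (bcat h w)).
  move=> /(_ (fun=> erefl) erefl) ->.
  suff E b : (qsat ((ocons b (ocons a (bcat h w)) \o omap Some) \o id) R /\
       forall b0, qsat (ocons b0 (ocons b (ocons a (bcat h w)) \o omap Some)
          \o omap Some) R ->
        b0 - (ocons b (ocons a (bcat h w)) \o omap Some) None = 0) <-> only b h.
    by split=> -[|[a0 none]]; auto; right; split=> // -[b bP]; apply: none;
      exists b; apply/E.
  exact: onlyE.
have f_ex h : exists a, qsat (ocons a (bcat h w)) f.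
  have [[b bP]|none] := classic (exists b, only b h).
    by exists b; apply/fP; left.
  by exists 0; apply/fP; right.
have f_uniq h a b : qsat (ocons a (bcat h w)) f -> qsat (ocons b (bcat h w)) f -> a = b.
  move=> /fP[oa|[-> none]] /fP[ob|[-> none']] //.
  - by case: ob => _; apply; case: oa.
  - by case: none'; exists a.
  - by case: none; exists b.
pose tup (a : m.-tuple M) j := tnth a (enum_rank j).
pose F a := xchoose (f_ex (tup a)).
case: (smallU m F).
  pose nu (v : option (J + W)) : term :=
    match v with
    | None => Var m
    | Some (inl j) => Var (enum_rank j)
    | Some (inr x) => Var (m.+1 + pickle x)
    end.
  pose e v := if unpickle (v - m.+1) is Some x then w x else 0.
  exists (qf_formula nu f), e; split; first exact: L_qf_formula.
  move=> a b; rewrite holds_qf_formula.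
  have -> : (fun v => eval (fun v => nth (e v) (rcons a b) v) (nu v)) =
      ocons b (bcat (tup a) w).
    apply: functional_extensionality => -[[j|x]|] /=.
    - rewrite nth_rcons size_tuple (ltn_ord (enum_rank j)) /tup (tnth_nth (e (enum_rank j))).
      by [].
    - rewrite nth_default ?size_rcons ?size_tuple; last by lia.
      by rewrite /e addKn pickleK.
    - by rewrite nth_rcons size_tuple ltnn eqxx.
  split=> [fb|<-]; last exact: (xchooseP (f_ex (tup a))).
  exact: f_uniq (xchooseP (f_ex (tup a))) fb.
move=> b bP; have [h hU hb] := covR b.
pose a := [tuple h (enum_val i) | i < m].
have tup_a : tup a = h.
  by apply: functional_extensionality => j; rewrite /tup tnth_mktuple enum_rankK.
apply: (bP a) => [i|]; first by rewrite tnth_mktuple.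
apply: f_uniq (xchooseP (f_ex (tup a))) _.
apply/fP; left; rewrite tup_a; split=> // b' hb'.
have [[|x [|//]] _ sP] := fibR h hU; first by move: (sP _ hb).
by move: (sP _ hb) (sP _ hb'); rewrite !inE => /eqP -> /eqP ->.
Qed.

Lemma exists_injection (K : closedFieldType) n :
  exists c : 'I_n -> K, injective c /\ forall i, c i != 0.
Proof.
suff [s] : exists s : seq K, [/\ uniq s, size s = n & 0 \notin s].
  move=> [s_uniq size_s s0]; exists (fun i => nth 0 s i); split=> [i j|i].
    move=> /eqP; rewrite nth_uniq ?size_s // => /eqP; exact: val_inj.
  by apply: contraNneq s0 => <-; rewrite mem_nth ?size_s.
elim: n => [|n [s [s_uniq size_s s0]]]; first by exists [::].
have /closed_nonrootP[a] : \prod_(x <- 0 :: s) ('X - x%:P) != 0 :> {poly K}.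
  by rewrite -size_poly_gt0 size_prod_XsubC.
rewrite root_prod_XsubC inE negb_or => /andP[a0 a_s].
by exists (a :: s); rewrite /= a_s s_uniq size_s inE eq_sym negb_or a0 s0.
Qed.

(* The polynomial-free analogue of "a field over which every element of K has
   degree at most d + 2": either some z0 is outside all the sets
   {z | for all i, z + c_i R_y = R_(y2 i)}, which are at most singletons, and then,
   with z0 as a new parameter, the sets R_y meet all (R_(y2 i) - z0) / c_i in
   fewer points, or these sets already form a cover with fibres of size 1. *)
Lemma covered_pred (M : structure) d :
  ~ covered M 1 -> covered M d.+2 -> covered M d.+1.
Proof.
move=> not1 [J [W [R [w [fibR covR]]]]].
(* There is one constant more than a fibre can have points. *)
have [c [c_inj c0]] := exists_injection M d.+3.
pose J1 := (J + 'I_d.+3 * J)%type; pose W1 := (option W + 'I_d.+3)%type.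
pose A (y : J -> M) a := qsat (ocons a (bcat y w)) R.
pose y2 (y : J1 -> M) i j := y (inr (i, j)).
pose y1 (y : J1 -> M) j := y (inl j).
have dA (V : Type) (rho : J + W -> V) (t : tm V) : qdef (fun K (e : V -> K) =>
    qsat (ocons (teval e t) (e \o rho)) R).
  pose s v := if v is Some v then TVar (rho v) else t.
  apply: qdef_ext (qdef_sub s (qdef_qf R)) => K e.
  suff -> : (fun v => teval e (s v)) = ocons (teval e t) (e \o rho) by [].
  by apply: functional_extensionality => -[].
pose r1 v : J1 + W1 :=
  match v with inl j => inl (inl j) | inr x => inr (inl (Some x)) end.
pose r2 i v : J1 + W1 :=
  match v with inl j => inl (inr (i, j)) | inr x => inr (inl (Some x)) end.
pose cv i : J1 + W1 := inr (inr i).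
pose w1 z : W1 -> M := bcat (ocons z w) c.
have r1E z (y : J1 -> M) : bcat y (w1 z) \o r1 = bcat (y1 y) w.
  by apply: functional_extensionality => -[].
have r2E z (y : J1 -> M) i : bcat y (w1 z) \o r2 i = bcat (y2 y i) w.
  by apply: functional_extensionality => -[].
(* The first fibre is required to be nonempty: if all fibres were empty, every [z] would satisfy the
   remaining conditions. *)
pose S y z := (exists b, A (y1 y) b) /\ forall i,
  (forall b, A (y1 y) b -> A (y2 y i) (z + c i * b)) /\
  (forall v, A (y2 y i) v -> exists b, A (y1 y) b /\ v = z + c i * b).
have [fS fSP] : exists fS : qf (option (J1 + W1)), forall y z,
    qsat (ocons z (bcat y (w1 0))) fS <-> S y z.
  have d0 := qdef_ex (dA _ (Some \o (Some \o r1)) (TVar None)).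
  have d1 i := qdef_all_elt (qdef_imp (dA _ (Some \o (Some \o r1)) (TVar None))
    (dA _ (Some \o (Some \o r2 i)) (TAdd (TVar (Some None))
       (TMul (TVar (Some (Some (cv i)))) (TVar None))))).
  have d2 i := qdef_all_elt (qdef_imp (dA _ (Some \o (Some \o r2 i)) (TVar None))
    (qdef_ex (qdef_and (dA _ (Some \o (Some \o (Some \o r1))) (TVar None))
       (qdef_eq0 (TAdd (TVar (Some None)) (TOpp (TAdd (TVar (Some (Some None)))
          (TMul (TVar (Some (Some (Some (cv i))))) (TVar None))))))))).
  have [f fP] := qdef_and d0 (qdef_forall_fin (fun i => qdef_and (d1 i) (d2 i))).
  exists f => y z; rewrite fP /S /A -(r1E 0 y).
  split=> -[S0 S1]; split=> // i; move: (S1 i) => [S2 S3]; split.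
  - by move=> b Ab; rewrite -(r2E 0 y i); apply: S2.
  - move=> v; rewrite -(r2E 0 y i) => /S3[b [Ab /eqP]].
    by rewrite subr_eq0 => /eqP vE; exists b.
  - by move=> b Ab; have := S2 b Ab; rewrite /A -(r2E 0 y i).
  - move=> v Av; have [|b [Ab vE]] := S3 v; first by rewrite /A -(r2E 0 y i).
    by exists b; split=> //=; apply/eqP; rewrite subr_eq0; apply/eqP.
(* For distinct [z] and [z'] the fibre at [y1 y] is stable under translation by (z' - z) / c_i for
   every [i], so one point [r] of it gives d + 3 distinct points. *)
have S_uniq y z z' : inU_all y -> S y z -> S y z' -> z = z'.
  move=> yU [[r Ar] Sz] [_ Sz']; apply: NNPP => /eqP zz'.
  have [s size_s As] := fibR (y1 y) (fun j => yU (inl j)).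
  pose t := [seq r + (z' - z) / c i | i : 'I_d.+3].
  have: (size t <= size s)%N.
    apply: uniq_leq_size.
      have dz0 : z' - z != 0 by rewrite subr_eq0 eq_sym.
      by rewrite map_inj_uniq ?enum_uniq // => i j /addrI/(mulfI dz0)/invr_inj/c_inj.
    move=> _ /mapP[i _ ->]; apply: As.
    have [_ /(_ (z' + c i * r))[|b [Ab E]]] := Sz i; first by case: (Sz' i) => ->.
    suff -> : r + (z' - z) / c i = b by [].
    apply: (mulfI (c0 i)); rewrite mulrDr mulrCA divff ?c0 // mulr1.
    by apply: (addrI z); rewrite -E; ring.
  by rewrite size_map -cardE card_ord leqNgt ltnS (leq_trans size_s).
have [z0 z0P] : exists z0, forall y, inU_all y -> ~ S y z0.
  apply: NNPP => none; apply: not1.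
  exists J1, W1, fS, (w1 0); split=> [y yU|z].
    have [[z Sz]|noz] := classic (exists z, S y z).
      by exists [:: z] => // a /fSP Sa; rewrite inE (S_uniq y a z).
    by exists [::] => // a /fSP Sa; case: noz; exists a.
  apply: NNPP => noy; apply: none; exists z => y yU Sz; apply: noy.
  by exists y => //; apply/fSP.
pose T y b := A (y1 y) b && [forall i, A (y2 y i) (z0 + c i * b)].
have [fT fTP] : exists fT : qf (option (J1 + W1)), forall y b,
    qsat (ocons b (bcat y (w1 z0))) fT <-> T y b.
  have dT i := dA _ (Some \o r2 i) (TAdd (TVar (Some (inr (inl None))))
     (TMul (TVar (Some (cv i))) (TVar None))).
  have [f fP] := qdef_and (dA _ (Some \o r1) (TVar None)) (qdef_forall_fin dT).
  exists f => y b; rewrite fP /T /A -(r1E z0 y); split=> [[-> T1]|/andP[-> /forallP T1]].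
    by apply/forallP=> i; move: (T1 i); rewrite -(r2E z0 y i).
  by split=> // i; move: (T1 i); rewrite -(r2E z0 y i).
exists J1, W1, fT, (w1 z0); split=> [y yU|b]; last first.
  have [h1 h1U Ab] := covR b.
  have [h2 h2U h2A] := fin_all_exists2 (fun i => covR (z0 + c i * b)).
  exists (bcat h1 (fun ij => h2 ij.1 ij.2)); last first.
    by apply/fTP; rewrite /T /A; apply/andP; split=> //; apply/forallP.
  by apply: inU_bcat => // -[i j]; apply: h2U.
have [s1 size_s1 s1P] := fibR (y1 y) (fun j => yU (inl j)).
pose s := [seq b <- undup s1 | T y b].
have sT b : T y b -> b \in s.
  by move=> Tb; rewrite mem_filter Tb mem_undup s1P //; case/andP: Tb.
(* A fibre of [T] with d + 2 points is the whole fibre at [y1 y]; its image under z0 + c_i b has as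
   many points, so it is the whole fibre at [y2 y i]. Then [S y z0] holds, against the choice of
   [z0]. *)
case: (leqP (size s) d.+1) => [size_s|size_s].
  by exists s => // b /fTP; apply: sT.
have s_uniq : uniq s by rewrite filter_uniq ?undup_uniq.
have [_ ss1] : (size s = size s1) * (s =i s1).
  apply: uniq_min_size => // [b|]; last exact: leq_trans size_s.
  by rewrite mem_filter mem_undup => /andP[].
have AT b : A (y1 y) b -> T y b.
  by move=> /s1P; rewrite -ss1 mem_filter => /andP[].
case: (z0P y yU); split.
  have : nth 0 s 0 \in s by rewrite mem_nth // (leq_ltn_trans _ size_s).
  by rewrite mem_filter => /andP[/andP[A0 _] _]; exists (nth 0 s 0).
move=> i; split=> [b /AT/andP[_ /forallP]|v Av]; first exact.
have [s2 size_s2 s2P] := fibR (y2 y i) (fun j => yU (inr (i, j))).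
pose t := [seq z0 + c i * b | b <- s].
have [_ ts2] : (size t = size s2) * (t =i s2).
  apply: uniq_min_size.
  - by rewrite map_inj_uniq // => a b /addrI/(mulfI (c0 i)).
  - move=> _ /mapP[b + ->]; rewrite mem_filter => /andP[/andP[_ /forallP Ab] _].
    exact/s2P/Ab.
  - by rewrite size_map (leq_trans size_s2).
have : v \in t by rewrite ts2; apply: s2P.
case/mapP=> b; rewrite mem_filter => /andP[/andP[Ab _] _] ->.
by exists b.
Qed.

Lemma not_covered (M : structure) d : ACF_m_Sigma M -> ~ covered M d.
Proof.
move=> /not_covered1 not1; case: d => [|d].
  move=> [J [W [R [w [fibR covR]]]]]; apply: not1.
  exists J, W, R, w; split=> // h /fibR[s size_s sP].
  by exists s => //; apply: leq_trans size_s _.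
by elim: d => // d IH /(covered_pred not1).
Qed.

(** * Formulas with quantifiers over U only *)

(** Blocks of variables are arbitrary finite types, so that duplicating a block only changes its
    index type. *)
Inductive pf (X : Type) (Y : finType) : Type :=
| PMat of qf (X + Y)
| PEx (J : finType) of pf X (J + Y)%type
| PAll (J : finType) of pf X (J + Y)%type.

Fixpoint psat (M : structure) X (x : X -> M) (Y : finType) (g : Y -> M)
    (f : pf X Y) {struct f} : Prop :=
  match f with
  | PMat m => qsat (bcat x g) m
  | PEx J f => exists2 h : J -> M, inU_all h & psat x (bcat h g) f
  | PAll J f => forall h : J -> M, inU_all h -> psat x (bcat h g) f
  end.

Definition pdef X (Y : finType)
    (P : forall M : structure, (X -> M) -> (Y -> M) -> Prop) :=
  exists f : pf X Y, forall M : structure, ACF_m_Sigma M ->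
    forall x g, inU_all g -> (psat x g f <-> P M x g).

Lemma inU_one (M : structure) (J : Type) :
  ACF_m_Sigma M -> exists h : J -> M, inU_all h.
Proof. by case=> -[_ U1 _ _] _ _; exists (fun=> 1). Qed.

Section PdefClosure.
Variable X : Type.

Lemma pdef_ext (Y : finType)
    (P Q : forall M : structure, (X -> M) -> (Y -> M) -> Prop) :
    (forall M : structure, ACF_m_Sigma M -> forall x g, inU_all g ->
       (P M x g <-> Q M x g)) ->
  pdef P -> pdef Q.
Proof.
by move=> PQ [f fP]; exists f => M hM x g gU; rewrite fP // PQ.
Qed.

Lemma pdef_pf (Y : finType) (f : pf X Y) : pdef (fun M x g => @psat M X x Y g f).
Proof. by exists f. Qed.

Lemma pdef_qdef (Y : finType)
    (P : forall K : closedFieldType, (X + Y -> K) -> Prop) :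
  qdef P -> pdef (fun M x g => P M (bcat x g)).
Proof. by case=> f fP; exists (PMat f) => M _ x g _; apply: fP. Qed.

Lemma pdef_not (Y : finType)
    (P : forall M : structure, (X -> M) -> (Y -> M) -> Prop) :
  pdef P -> pdef (fun M x g => ~ P M x g).
Proof.
case=> f fP; suff [f' f'P] : pdef (fun M x g => ~ @psat M X x Y g f).
  by exists f' => M hM x g gU; rewrite f'P // fP.
elim: f {P fP} => [{}Y m|{}Y J f [f' f'P]|{}Y J f [f' f'P]].
- by exists (PMat (QNot m)) => M hM x g gU /=; split=> /negP.
- exists (PAll f') => M hM x g gU /=; split=> [H [h hU fh]|none h hU].
    by move: fh; apply/(f'P M hM x _ (inU_bcat hU gU)); apply: H.
  by apply/(f'P M hM x _ (inU_bcat hU gU)) => fh; apply: none; exists h.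
- exists (PEx f') => M hM x g gU /=; split=> [[h hU f'h] H|nall].
    by move: f'h => /(f'P M hM x _ (inU_bcat hU gU)); apply; apply: H.
  apply: NNPP => none; apply: nall => h hU; apply: NNPP => nfh; apply: none.
  by exists h => //; apply/(f'P M hM x _ (inU_bcat hU gU)).
Qed.

Lemma pdef_ex (Y J : finType)
    (P : forall M : structure, (X -> M) -> (J + Y -> M) -> Prop) :
    pdef P ->
  pdef (fun M x (g : Y -> M) => exists2 h : J -> M, inU_all h & P M x (bcat h g)).
Proof.
case=> f fP; exists (PEx f) => M hM x g gU /=.
by split=> -[h hU H]; exists h => //; apply/(fP M hM x _ (inU_bcat hU gU)).
Qed.

Lemma pdef_all (Y J : finType)
    (P : forall M : structure, (X -> M) -> (J + Y -> M) -> Prop) :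
    pdef P ->
  pdef (fun M x (g : Y -> M) => forall h : J -> M, inU_all h -> P M x (bcat h g)).
Proof.
case=> f fP; exists (PAll f) => M hM x g gU /=.
by split=> H h hU; apply/(fP M hM x _ (inU_bcat hU gU)); apply: H.
Qed.

End PdefClosure.

(** Field variables admit arbitrary terms, but variables ranging over U only renamings, since sums
    and opposites may leave U. *)
Lemma pdef_sub X X' (Y Y' : finType) (s : X -> tm X') (r : Y -> Y')
    (P : forall M : structure, (X -> M) -> (Y -> M) -> Prop) :
    pdef P ->
  pdef (fun M (x : X' -> M) (g : Y' -> M) =>
          P M (fun v => teval x (s v)) (g \o r)).
Proof.
case=> f fP.
suff [f' f'P] : pdef (fun M (x : X' -> M) (g : Y' -> M) =>
    psat (fun v => teval x (s v)) (g \o r) f).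
  by exists f' => M hM x g gU; rewrite f'P // fP // => y; apply: gU.
pose lift (J Z Z' : finType) (t : Z -> Z') (v : J + Z) : J + Z' :=
  match v with inl j => inl j | inr z => inr (t z) end.
have liftE (M : structure) (J Z Z' : finType) (t : Z -> Z') (h : J -> M) g :
    bcat h (g \o t) = bcat h g \o @lift J Z Z' t.
  by apply: functional_extensionality => -[].
elim: f Y' r {P fP} => [{}Y m|{}Y J f IH|{}Y J f IH] Y' r.
- pose t v : tm (X' + Y') := match v with
    | inl v => tsub (fun u => TVar (inl u)) (s v)
    | inr y => TVar (inr (r y)) end.
  apply: pdef_ext (pdef_qdef (qdef_sub t (qdef_qf m))) => M hM x g gU /=.
  suff -> : (fun v => teval (bcat x g) (t v)) =
    bcat (fun v => teval x (s v)) (g \o r) by [].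
  by apply: functional_extensionality => -[v|y] //=; rewrite teval_tsub.
- apply: pdef_ext (pdef_ex (IH _ (@lift J _ _ r))) => M hM x g gU /=.
  by split=> -[h hU H]; exists h => //; move: H; rewrite liftE.
- apply: pdef_ext (pdef_all (IH _ (@lift J _ _ r))) => M hM x g gU /=.
  by split=> H h hU; move: (H h hU); rewrite liftE.
Qed.

Lemma pdef_ren X (Y Y' : finType) (r : Y -> Y')
    (P : forall M : structure, (X -> M) -> (Y -> M) -> Prop) :
  pdef P -> pdef (fun M x (g : Y' -> M) => P M x (g \o r)).
Proof. exact: (pdef_sub (@TVar X)). Qed.

Section PdefBoolean.
Variable X : Type.

Lemma pdef_and (Y : finType)
    (P Q : forall M : structure, (X -> M) -> (Y -> M) -> Prop) :
  pdef P -> pdef Q -> pdef (fun M x g => P M x g /\ Q M x g).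
Proof.
move=> [f1 f1P] dQ.
suff [f fP] : pdef (fun M x g => @psat M X x Y g f1 /\ Q M x g).
  by exists f => M hM x g gU; rewrite fP // f1P.
have inrE (M : structure) (J Z : finType) (h : J -> M) (g : Z -> M) :
    bcat h g \o inr = g by [].
elim: f1 Q dQ {P f1P} => [{}Y m|{}Y J f1 IH|{}Y J f1 IH] Q dQ /=.
- have [f2 f2P] := dQ; suff [f fP] : pdef (fun M x g =>
      qsat (bcat x g) m /\ @psat M X x Y g f2).
    by exists f => M hM x g gU; rewrite fP // f2P.
  elim: f2 m {Q dQ f2P} => [{}Y m2|{}Y J f2 IH|{}Y J f2 IH] m /=.
  + apply: (pdef_ext _ (pdef_qdef (qdef_and (qdef_qf m) (qdef_qf m2)))) => *.
    exact: iff_refl.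
  + pose r v : X + (J + Y) := match v with inl v => inl v | inr y => inr (inr y) end.
    apply: pdef_ext (pdef_ex (IH (qsub (fun v => TVar (r v)) m))) => M hM x g gU.
    have mE h : qsat (bcat x (bcat h g)) (qsub (fun v => TVar (r v)) m) =
        qsat (bcat x g) m.
      rewrite qsat_qsub; congr qsat.
      by apply: functional_extensionality => -[].
    split=> [[h hU []]|[ms [h hU H]]]; last by exists h => //; rewrite mE.
    by rewrite mE => ms H; split=> //; exists h.
  + pose r v : X + (J + Y) := match v with inl v => inl v | inr y => inr (inr y) end.
    apply: pdef_ext (pdef_all (IH (qsub (fun v => TVar (r v)) m))) => M hM x g gU.
    have mE h : qsat (bcat x (bcat h g)) (qsub (fun v => TVar (r v)) m) =
        qsat (bcat x g) m.
      rewrite qsat_qsub; congr qsat.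
      by apply: functional_extensionality => -[].
    (* A block has at least one value, as 1 lies in U; this recovers the conjunct that stands
       outside the universal quantifier. *)
    have [h1 h1U] := inU_one J hM.
    split=> [H|[ms H] h hU]; last by rewrite mE; auto.
    split=> [|h hU]; last by case: (H h hU).
    by case: (H h1 h1U); rewrite mE.
- apply: pdef_ext (pdef_ex (IH _ (pdef_ren inr dQ))) => M hM x g gU.
  split=> [[h hU [H1 H2]]|[[h hU H] Qg]]; first by split=> //; exists h.
  by exists h.
- apply: pdef_ext (pdef_all (IH _ (pdef_ren inr dQ))) => M hM x g gU.
  have [h1 h1U] := inU_one J hM.
  split=> [H|[H Qg] h hU]; last by split=> //; apply: H.
  by split=> [h hU|]; [case: (H h hU)|case: (H h1 h1U)].
Qed.

Lemma pdef_or (Y : finType)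
    (P Q : forall M : structure, (X -> M) -> (Y -> M) -> Prop) :
  pdef P -> pdef Q -> pdef (fun M x g => P M x g \/ Q M x g).
Proof.
move=> dP dQ; apply: pdef_ext (pdef_not (pdef_and (pdef_not dP) (pdef_not dQ))).
by move=> M hM x g gU; split=> ?; tauto.
Qed.

Lemma pdef_imp (Y : finType)
    (P Q : forall M : structure, (X -> M) -> (Y -> M) -> Prop) :
  pdef P -> pdef Q -> pdef (fun M x g => P M x g -> Q M x g).
Proof.
move=> dP dQ; apply: pdef_ext (pdef_not (pdef_and dP (pdef_not dQ))).
by move=> M hM x g gU; split=> ?; tauto.
Qed.

End PdefBoolean.

(** * Eliminating quantifiers over the field *)

Lemma qdef_ex_left X Y (P : forall K : closedFieldType, (option X + Y -> K) -> Prop) :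
    qdef P ->
  qdef (fun K (e : X + Y -> K) =>
          exists a, P K (bcat (ocons a (e \o inl)) (e \o inr))).
Proof.
move=> dP; pose s (v : option X + Y) : option (X + Y) :=
  match v with inl v => omap inl v | inr y => Some (inr y) end.
apply: qdef_ext (qdef_ex (qdef_ren s dP)) => K e.
have sE a : ocons a e \o s = bcat (ocons a (e \o inl)) (e \o inr).
  by apply: functional_extensionality => -[[v|]|y].
by split=> -[a aP]; exists a; move: aP; rewrite sE.
Qed.

Definition finite_le (M : structure) (d : nat) (P : M -> Prop) :=
  exists2 s : seq M, (size s <= d)%N & forall a, P a -> a \in s.

(* A quantifier over a set of at most d elements commutes with the quantifiers
   over U, at the price of d copies of the universally quantified variables. The
   family of renamings r makes the statement stable under this duplication. *)
Lemma pdef_ex_finite X (Y : finType) (f : pf (option X) Y) (I Y' : finType)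
    (r : I -> Y -> Y') (q : qf (option X + Y')) (d : nat) :
  exists f' : pf X Y', forall M : structure, ACF_m_Sigma M ->
    forall x (g : Y' -> M), inU_all g ->
    finite_le d (fun a => qsat (bcat (ocons a x) g) q) ->
    (psat x g f' <-> exists2 a, qsat (bcat (ocons a x) g) q &
       forall i, psat (ocons a x) (g \o r i) f).
Proof.
pose wk (J Z : finType) : qf (option X + Z) -> qf (option X + (J + Z)) :=
  qsub (fun v => TVar (match v with inl v => inl v | inr z => inr (inr z) end)).
have wkE (M : structure) (J Z : finType) (x : option X -> M) (h : J -> M)
    (g : Z -> M) q0 : qsat (bcat x (bcat h g)) (wk J Z q0) = qsat (bcat x g) q0.
  by rewrite qsat_qsub; congr qsat; apply: functional_extensionality => -[].
elim: f I Y' r q => [{}Y m|{}Y J f IH|{}Y J f IH] I Y' r q.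
- pose t i (v : option X + Y) : option X + Y' :=
    match v with inl v => inl v | inr y => inr (r i y) end.
  have dm i := qdef_ren (t i) (qdef_qf m).
  have [f' f'P] := pdef_qdef (qdef_ex_left (qdef_and (qdef_qf q) (qdef_forall_fin dm))).
  exists f' => M hM x g gU _; rewrite f'P //.
  have tE a i : bcat (ocons a x) g \o t i = bcat (ocons a x) (g \o r i).
    by apply: functional_extensionality => -[].
  by split=> [[a [qa H]]|[a qa H]]; exists a; rewrite -?tE;
    [|move=> i; rewrite /= -tE; apply: H|split=> // i; rewrite tE; apply: H].
(* Each conjunct [i] may need its own witness, hence a block indexed by [I * J]. *)
- pose r' i (v : J + Y) : (I * J) + Y' :=
    match v with inl j => inl (i, j) | inr y => inr (r i y) end.
  have [f' f'P] := IH I _ r' (wk _ _ q).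
  exists (PEx f') => M hM x g gU [s size_s sP] /=.
  have r'E (H : I * J -> M) i : bcat H g \o r' i = bcat (fun j => H (i, j)) (g \o r i).
    by apply: functional_extensionality => -[].
  have fin (H : I * J -> M) : finite_le d (fun a => qsat (bcat (ocons a x) (bcat H g))
      (wk _ _ q)).
    by exists s => // a; rewrite wkE; apply: sP.
  split=> [[H HU]|[a qa fa]].
    rewrite f'P //; last exact: inU_bcat.
    case=> a; rewrite wkE => qa fa; exists a => // i.
    by exists (fun j => H (i, j)) => [j|]; rewrite -?r'E //; apply: HU.
  have [h hU hf] := fin_all_exists2 fa.
  exists (fun ij => h ij.1 ij.2) => [[i j]|]; first exact: hU.
  rewrite f'P //; last by apply: inU_bcat => // -[i j]; apply: hU.
  exists a; rewrite ?wkE // => i; rewrite r'E; exact: hf.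
- pose r' (ti : 'I_d * I) (v : J + Y) : ('I_d * J) + Y' :=
    match v with inl j => inl (ti.1, j) | inr y => inr (r ti.2 y) end.
  have [f' f'P] := IH _ _ r' (wk _ _ q).
  exists (PAll f') => M hM x g gU [s size_s sP] /=.
  have r'E (H : 'I_d * J -> M) ti :
      bcat H g \o r' ti = bcat (fun j => H (ti.1, j)) (g \o r ti.2).
    by apply: functional_extensionality => -[].
  have fin (H : 'I_d * J -> M) : finite_le d (fun a => qsat (bcat (ocons a x) (bcat H g))
      (wk _ _ q)).
    by exists s => // a; rewrite wkE; apply: sP.
  split=> [H|[a qa fa] H HU]; last first.
    rewrite f'P //; last exact: inU_bcat.
    by exists a; rewrite ?wkE // => ti; rewrite r'E; apply: fa => j; apply: HU.
  apply: NNPP => none.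
  (* If every point of the finite set fails, the blocks refuting them form together a single value
     of the enlarged block, at which no point survives. Positions beyond the end of [s] hold the
     default 0; if 0 is not in the set, any block in U will do. *)
  have bad (t : 'I_d) : exists h : J -> M, inU_all h /\
      (qsat (bcat (ocons (nth 0 s t) x) g) q ->
       exists i, ~ psat (ocons (nth 0 s t) x) (bcat h (g \o r i)) f).
    apply: NNPP => nbad; apply: none; exists (nth 0 s t).
      apply: NNPP => nq; apply: nbad.
      by have [h hU] := inU_one J hM; exists h; split.
    move=> i h hU; apply: NNPP => nf; apply: nbad; exists h; split=> // _.
    by exists i.
  have [h hP] := fin_all_exists bad.
  have HU : inU_all (fun tj => h tj.1 tj.2) by move=> [t j]; case: (hP t) => + _; apply.
  move: (H _ HU); rewrite f'P //; last exact: inU_bcat.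
  case=> a; rewrite wkE => qa fa; have a_s := sP _ qa.
  have lt_t : (index a s < d)%N by apply: leq_trans size_s; rewrite index_mem.
  have [_] := hP (Ordinal lt_t); rewrite /= nth_index // => /(_ qa)[i []].
  by have := fa (Ordinal lt_t, i); rewrite r'E.
Qed.

Definition xpoly X Y (t : tm (option X + Y)) : seq (tm (X + Y)) :=
  tpoly (tsub (fun v => TVar (match v with
    | inl v => omap inl v
    | inr y => Some (inr y)
    end)) t).

Lemma horner_xpoly (K : closedFieldType) X Y (x : X -> K) (g : Y -> K) a t :
  (peval (bcat x g) (xpoly t)).[a] = teval (bcat (ocons a x) g) t.
Proof.
rewrite horner_tpoly teval_tsub; congr teval.
by apply: functional_extensionality => -[[v|]|y].
Qed.

(* The new value a is generic over x when it is a root of a polynomial occurring in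
   the formula only if that polynomial vanishes identically. *)
Fixpoint qgeneric (K : closedFieldType) X Y (x : X -> K) (g : Y -> K) (a : K)
    (m : qf (option X + Y)) : Prop :=
  match m with
  | QEq t => teval (bcat (ocons a x) g) t = 0 -> peval (bcat x g) (xpoly t) = 0
  | QNot m => qgeneric x g a m
  | QAnd m n => qgeneric x g a m /\ qgeneric x g a n
  end.

(** Genericity is demanded at all values of a block, whichever the quantifier, so that the matrix
    can be replaced under any prefix. *)
Fixpoint pgeneric (M : structure) X (x : X -> M) (Y : finType) (g : Y -> M) (a : M)
    (f : pf (option X) Y) {struct f} : Prop :=
  match f with
  | PMat m => qgeneric x g a m
  | PEx J f => forall h : J -> M, inU_all h -> pgeneric x (bcat h g) a f
  | PAll J f => forall h : J -> M, inU_all h -> pgeneric x (bcat h g) a f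
  end.

Section Generic.
Variable X : Type.

Lemma generic_qsat Y (m : qf (option X + Y)) :
  exists m' : qf (X + Y), forall (K : closedFieldType) (x : X -> K) (g : Y -> K) a,
    qgeneric x g a m -> qsat (bcat (ocons a x) g) m = qsat (bcat x g) m'.
Proof.
elim: m => [t|m [m' mP]|m [m' mP] n [n' nP]].
- have [m' mP] := qdef_peval_eq0 (xpoly t); exists m' => K x g a /= gen.
  apply/eqP/idP => [ta|/mP pt]; first by apply/mP/gen.
  by rewrite -horner_xpoly pt horner0.
- by exists (QNot m') => K x g a /= gen; rewrite mP.
- by exists (QAnd m' n') => K x g a /= [genm genn]; rewrite mP ?nP.
Qed.

Lemma generic_psat (Y : finType) (f : pf (option X) Y) :
  exists f' : pf X Y, forall (M : structure) (x : X -> M) (g : Y -> M) a,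
    pgeneric x g a f -> (psat (ocons a x) g f <-> psat x g f').
Proof.
elim: f => [{}Y m|{}Y J f [f' f'P]|{}Y J f [f' f'P]].
- by have [m' mP] := generic_qsat m; exists (PMat m') => M x g a /= gen; rewrite mP.
- exists (PEx f') => M x g a /= gen.
  by split=> -[h hU H]; exists h => //; apply/(f'P M x _ a (gen h hU)).
- exists (PAll f') => M x g a /= gen.
  by split=> H h hU; apply/(f'P M x _ a (gen h hU)); apply: H.
Qed.

Lemma nongeneric_root_finite (M : structure) Y (x : X -> M) (g : Y -> M)
    (t : tm (option X + Y)) :
  finite_le (size (xpoly t))
    (fun a => peval (bcat x g) (xpoly t) <> 0 /\ teval (bcat (ocons a x) g) t = 0).
Proof.
have [p0|/eqP p0] := eqVneq (peval (bcat x g) (xpoly t)) 0.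
  by exists [::] => // a [].
have [s def_p] := closed_field_poly_normal (peval (bcat x g) (xpoly t)).
have lead0 : lead_coef (peval (bcat x g) (xpoly t)) != 0.
  by rewrite lead_coef_eq0; apply/eqP.
exists s => [|a [_ ta]].
  apply: leq_trans (size_peval (bcat x g) _).
  by rewrite def_p size_scale // size_prod_XsubC.
by rewrite -root_prod_XsubC -(rootZ _ _ lead0) -def_p rootE horner_xpoly ta.
Qed.

Lemma qdef_nongeneric_root Y (t : tm (option X + Y)) :
  qdef (fun (K : closedFieldType) (e : option X + Y -> K) =>
    peval (bcat (e \o inl \o Some) (e \o inr)) (xpoly t) <> 0 /\ teval e t = 0).
Proof.
pose s v : option X + Y := match v with inl v => inl (Some v) | inr y => inr y end.
have d1 := qdef_not (qdef_ren s (qdef_peval_eq0 (xpoly t))).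
apply: qdef_ext (qdef_and d1 (qdef_eq0 t)) => K e.
suff -> : bcat (e \o inl \o Some) (e \o inr) = e \o s by [].
by apply: functional_extensionality => -[].
Qed.

(** Not being generic is an existential condition: some block in U and some polynomial, nonzero
    there, with [a] as a root. Once the block is quantified outside, [a] ranges over a finite set
    and [pdef_ex_finite] applies. The induction takes [f] apart while [f0] has to stay whole, hence
    two formulas. *)
Lemma pdef_ex_nongeneric (Y Y' : finType) (f : pf (option X) Y) (r : Y -> Y')
    (f0 : pf (option X) Y') :
  pdef (fun M (x : X -> M) (g : Y' -> M) =>
    exists2 a, ~ pgeneric x (g \o r) a f & psat (ocons a x) g f0).
Proof.
have block (Z J : finType) (f1 : pf (option X) (J + Z)%type) :
    (forall (Y1 : finType) (r1 : J + Z -> Y1) (f2 : pf (option X) Y1),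
      pdef (fun M (x : X -> M) (g : Y1 -> M) =>
        exists2 a, ~ pgeneric x (g \o r1) a f1 & psat (ocons a x) g f2)) ->
    forall (Y1 : finType) (r1 : Z -> Y1) (f2 : pf (option X) Y1),
      pdef (fun M (x : X -> M) (g : Y1 -> M) => exists2 a,
        ~ (forall h : J -> M, inU_all h -> pgeneric x (bcat h (g \o r1)) a f1) &
        psat (ocons a x) g f2).
  move=> IH Y1 r1 f2; have [f3 f3P] := pdef_ren (@inr J Y1) (pdef_pf f2).
  pose lift (v : J + Z) : J + Y1 :=
    match v with inl j => inl j | inr z => inr (r1 z) end.
  apply: pdef_ext (pdef_ex (IH _ lift f3)) => M hM x g gU.
  have liftE (h : J -> M) : bcat h g \o lift = bcat h (g \o r1).
    by apply: functional_extensionality => -[].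
  split=> [[h hU [a]]|[a ngen fa]].
    rewrite liftE => ngen /(f3P M hM _ _ (inU_bcat hU gU)) fa.
    by exists a => // gen; apply: ngen; apply: gen.
  apply: NNPP => none; apply: ngen => h hU; apply: NNPP => ngen; apply: none.
  exists h => //; exists a; first by rewrite liftE.
  exact/(f3P M hM _ _ (inU_bcat hU gU)).
elim: f Y' r f0 => [{}Y m|{}Y J f IH|{}Y J f IH] Y' r f0; last 2 first.
- exact: block IH Y' r f0.
- exact: block IH Y' r f0.
- elim: m => [t|m IH|m IHm n IHn] //=.
    pose s v : option X + Y' :=
      match v with inl v => inl v | inr y => inr (r y) end.
    have [q qP] := qdef_ren s (qdef_nongeneric_root t).
    have [f' f'P] := pdef_ex_finite f0 (fun _ : unit => id) q (size (xpoly t)).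
    exists f' => M hM x g gU.
    have {}qP a : qsat (bcat (ocons a x) g) q <->
        peval (bcat x (g \o r)) (xpoly t) <> 0 /\
        teval (bcat (ocons a x) (g \o r)) t = 0.
      rewrite qP; have -> : bcat (ocons a x) g \o s = bcat (ocons a x) (g \o r).
        by apply: functional_extensionality => -[].
      by [].
    have fin : finite_le (size (xpoly t)) (fun a => qsat (bcat (ocons a x) g) q).
      have [l size_l lP] := nongeneric_root_finite x (g \o r) t.
      by exists l => // a /qP/lP.
    rewrite f'P //; split=> [[a /qP[p0 ta] fa]|[a ngen fa]].
      by exists a => [/(_ ta)//|]; apply: fa tt.
    by exists a => [|_ //]; apply/qP; split=> [p0|]; [|apply: NNPP => ta]; apply: ngen.
  apply: pdef_ext (pdef_or IHm IHn) => M hM x g gU.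
  split=> [[|] [a ngen fa]|[a ngen fa]]; try by exists a => // -[].
  have [genm|ngenm] := classic (qgeneric x (g \o r) a m).
    by right; exists a => // genn; apply: ngen.
  by left; exists a.
Qed.

Lemma nongeneric_qcover Y (m : qf (option X + Y)) :
  exists (R : qf (option X + Y)) (d : nat),
    forall (M : structure) (x : X -> M) (g : Y -> M),
      finite_le d (fun a => qsat (bcat (ocons a x) g) R) /\
      forall a, ~ qgeneric x g a m -> qsat (bcat (ocons a x) g) R.
Proof.
elim: m => [t|//|m [R [d RP]] n [S [d' SP]]].
  have [R RP] := qdef_nongeneric_root t.
  exists R, (size (xpoly t)) => M x g; split=> [|a ngen]; last first.
    by apply/RP; split=> [p0|]; [|apply: NNPP => ta]; apply: ngen.
  have [s size_s sP] := nongeneric_root_finite x g t.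
  by exists s => // a /RP; apply: sP.
have [RS RSP] := qdef_or (qdef_qf R) (qdef_qf S).
exists RS, (d + d')%N => M x g.
have [[s1 size_s1 s1P] Rcov] := RP M x g; have [[s2 size_s2 s2P] Scov] := SP M x g.
split=> [|a ngen].
  exists (s1 ++ s2); first by rewrite size_cat leq_add.
  by move=> a /RSP[/s1P|/s2P]; rewrite mem_cat => ->; rewrite ?orbT.
apply/RSP; have [genm|] := classic (qgeneric x g a m); last by left; apply: Rcov.
by right; apply: Scov => genn; apply: ngen.
Qed.

(** Nongenericity read as a definable family indexed by a power of U; the bound [d] depends on the
    formula only. This is the family to which [not_covered] is applied. *)
Lemma nongeneric_cover (Y : finType) (f : pf (option X) Y) :
  exists (J : finType) (R : qf (option X + (J + Y))) (d : nat),
    forall (M : structure) (x : X -> M) (g : Y -> M),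
      (forall h : J -> M, finite_le d (fun a => qsat (bcat (ocons a x) (bcat h g)) R)) /\
      forall a, ~ pgeneric x g a f ->
        exists2 h : J -> M, inU_all h & qsat (bcat (ocons a x) (bcat h g)) R.
Proof.
have block (Z J : finType) (f1 : pf (option X) (J + Z)%type) :
    (exists (J1 : finType) (R : qf (option X + (J1 + (J + Z)))) (d : nat),
      forall (M : structure) (x : X -> M) (g : J + Z -> M),
      (forall h : J1 -> M, finite_le d (fun a => qsat (bcat (ocons a x) (bcat h g)) R)) /\
      forall a, ~ pgeneric x g a f1 ->
        exists2 h : J1 -> M, inU_all h & qsat (bcat (ocons a x) (bcat h g)) R) ->
    exists (J1 : finType) (R : qf (option X + (J1 + Z))) (d : nat),
      forall (M : structure) (x : X -> M) (g : Z -> M),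
      (forall h : J1 -> M, finite_le d (fun a => qsat (bcat (ocons a x) (bcat h g)) R)) /\
      forall a, ~ (forall h : J -> M, inU_all h -> pgeneric x (bcat h g) a f1) ->
        exists2 h : J1 -> M, inU_all h & qsat (bcat (ocons a x) (bcat h g)) R.
  move=> [J1 [R [d RP]]].
  pose s (v : option X + (J1 + (J + Z))) : option X + ((J1 + J) + Z) :=
    match v with
    | inl v => inl v
    | inr (inl j) => inr (inl (inl j))
    | inr (inr (inl j)) => inr (inl (inr j))
    | inr (inr (inr z)) => inr (inr z)
    end.
  have [R' R'P] := qdef_ren s (qdef_qf R).
  exists (J1 + J)%type, R', d => M x g.
  have sE a (h : J1 + J -> M) : bcat (ocons a x) (bcat h g) \o s =
      bcat (ocons a x) (bcat (h \o inl) (bcat (h \o inr) g)).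
    by apply: functional_extensionality => -[|[|[]]].
  split=> [h|a ngen].
    have [fin _] := RP M x (bcat (h \o inr) g).
    have [l size_l lP] := fin (h \o inl).
    by exists l => // a /R'P; rewrite sE; apply: lP.
  apply: NNPP => none; apply: ngen => h hU; apply: NNPP => ngen; apply: none.
  have [_ /(_ a ngen)[h1 h1U Rh]] := RP M x (bcat h g).
  exists (bcat h1 h); first exact: inU_bcat.
  by apply/R'P; rewrite sE.
elim: f => [{}Y m|{}Y J f /block //|{}Y J f /block //].
have [R [d RP]] := nongeneric_qcover m.
pose s (v : option X + Y) : option X + (void + Y) :=
  match v with inl v => inl v | inr y => inr (inr y) end.
have [R' R'P] := qdef_ren s (qdef_qf R).
exists void, R', d => M x g; have [[l size_l lP] cov] := RP M x g.
have sE a (h : void -> M) : bcat (ocons a x) (bcat h g) \o s = bcat (ocons a x) g.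
  by apply: functional_extensionality => -[].
split=> [h|a ngen]; first by exists l => // a /R'P; rewrite sE; apply: lP.
exists (of_void M); first by case.
by apply/R'P; rewrite sE; apply: cov.
Qed.

End Generic.

(** Without a generic element the nongeneric ones would cover K. The values of [X] become parameters
    of that cover, whence the countability of [X]. *)
Lemma exists_generic (X : countType) (Y : finType) (f : pf (option X) Y)
    (M : structure) (x : X -> M) (g : Y -> M) :
  ACF_m_Sigma M -> exists a, pgeneric x g a f.
Proof.
move=> hM; apply: NNPP => none.
have [J [R [d RP]]] := nongeneric_cover f.
apply: (not_covered (d := d) hM).
pose s (v : option X + (J + Y)) : option (J + (X + Y)) :=
  match v with
  | inl v => omap (inr \o inl) v
  | inr (inl j) => Some (inl j)
  | inr (inr y) => Some (inr (inr y))
  end.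
have [R' R'P] := qdef_ren s (qdef_qf R).
have sE a (h : J -> M) : ocons a (bcat h (bcat x g)) \o s =
    bcat (ocons a x) (bcat h g).
  by apply: functional_extensionality => -[[]|[]].
have [fin cov] := RP M x g.
exists J, (X + Y)%type, R', (bcat x g); split=> [h _|a].
  by have [l size_l lP] := fin h; exists l => // a /R'P; rewrite sE; apply: lP.
have [|h hU Rh] := cov a; first by move=> gen; apply: none; exists a.
by exists h => //; apply/R'P; rewrite sE.
Qed.

Lemma pdef_ex_left (X : countType) (Y : finType)
    (P : forall M : structure, (option X -> M) -> (Y -> M) -> Prop) :
  pdef P -> pdef (fun M (x : X -> M) g => exists a, P M (ocons a x) g).
Proof.
move=> [f fP]; have [f1 f1P] := generic_psat f.
(* Generic elements exist and all agree on [f], so their share of the quantifier is the single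
   formula [f1], free of the new variable. *)
apply: pdef_ext (pdef_or (pdef_pf f1) (pdef_ex_nongeneric f id f)) => M hM x g gU.
split=> [[f1x|[a ngen fa]]|[a /(fP M hM _ _ gU) fa]].
- have [a gen] := exists_generic f x g hM.
  by exists a; apply/(fP M hM _ _ gU)/(f1P M x g a gen).
- by exists a; apply/(fP M hM _ _ gU).
have [gen|ngen] := classic (pgeneric x g a f); last by right; exists a.
by left; apply/(f1P M x g a gen).
Qed.

Lemma pdef_forall_fin X (Y T : finType)
    (P : T -> forall M : structure, (X -> M) -> (Y -> M) -> Prop) :
  (forall i, pdef (P i)) -> pdef (fun M x g => forall i, P i M x g).
Proof.
move=> dP.
suff: pdef (fun M x g => forall i, i \in enum T -> P i M x g).
  by apply: pdef_ext => M hM x g gU; split=> H i; [apply: H; rewrite mem_enum|move=> _].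
elim: (enum T) => [|i s IH].
  by apply: pdef_ext (pdef_qdef (qdef_true (X + Y))).
apply: pdef_ext (pdef_and (dP i) IH) => M hM x g gU; split=> [[Pi Ps] j|Ps].
  by rewrite inE => /orP[/eqP ->|/Ps].
by split=> [|j js]; apply: Ps; rewrite inE ?eqxx ?js ?orbT.
Qed.

(** * Translation of the full language *)

Fixpoint of_term (t : term) : tm nat :=
  match t with
  | Var v => TVar v
  | Zero => TZero
  | One => TOne
  | Add s t => TAdd (of_term s) (of_term t)
  | Opp t => TOpp (of_term t)
  | Mul s t => TMul (of_term s) (of_term t)
  end.

Lemma teval_of_term (M : structure) (e : nat -> M) t :
  teval e (of_term t) = eval e t.
Proof. by elim: t => //= [s -> t ->|t ->|s -> t ->]. Qed.

Definition tmulz V (t : tm V) (k : int) : tm V :=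
  match k with
  | Posz n => iter n (TAdd t) TZero
  | Negz n => TOpp (iter n.+1 (TAdd t) TZero)
  end.

Lemma teval_tmulz (R : nzRingType) V (e : V -> R) t k :
  teval e (tmulz t k) = teval e t *~ k.
Proof.
have natE n : teval e (iter n (TAdd t) TZero) = teval e t *+ n.
  by elim: n => [|n IH] //=; rewrite IH mulrS.
case: k => n; first exact: natE.
by rewrite NegzE mulrNz -pmulrn -natE.
Qed.

Definition tsum V (ts : seq (tm V)) : tm V := foldr (@TAdd V) TZero ts.

Lemma teval_tsum (R : nzRingType) V (e : V -> R) ts :
  teval e (tsum ts) = \sum_(t <- ts) teval e t.
Proof. by elim: ts => [|t ts IH]; rewrite ?big_nil // big_cons /= IH. Qed.

Lemma pdef_formula (phi : formula) :
  pdef (fun M (x : nat -> M) (_ : void -> M) => holds x phi).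
Proof.
have dEq (t : tm nat) : pdef (fun M (x : nat -> M) (_ : void -> M) => teval x t = 0).
  have dt := pdef_qdef (qdef_eq0 (tsub (fun v => TVar (inl v) : tm (nat + void)) t)).
  by apply: (pdef_ext _ dt) => M hM x g gU; rewrite teval_tsub.
have dU t : pdef (fun M (x : nat -> M) (_ : void -> M) => U_interp (eval x t)).
  pose u : tm (nat + (unit + void)) := TAdd (tsub (fun v => TVar (inl v)) (of_term t))
    (TOpp (TVar (inr (inl tt)))).
  apply: pdef_ext (pdef_ex (pdef_qdef (qdef_eq0 u))) => M hM x g gU /=.
  split=> [[h hU /eqP]|Ut].
    rewrite teval_tsub teval_of_term subr_eq0 => /eqP ->; exact: hU.
  exists (fun=> eval x t) => //.
  by rewrite teval_tsub teval_of_term subrr.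
elim: phi => [s t|t|n k ts|f IH|f IHf g IHg|f IHf g IHg|f IHf g IHg|v f IH|v f IH].
- apply: pdef_ext (dEq (TAdd (of_term s) (TOpp (of_term t)))) => M hM x g gU /=.
  rewrite !teval_of_term; split=> [/eqP|->]; last exact: subrr.
  by rewrite subr_eq0 => /eqP.
- exact: dU.
- pose t := tsum [seq tmulz (of_term (tnth ts i)) (tnth k i) | i : 'I_n].
  apply: pdef_ext (pdef_and (pdef_forall_fin (fun i => dU (tnth ts i))) (dEq t)).
  move=> M [_ _ sigM] x g gU /=; rewrite sigM.
  have -> : teval x t = \sum_(i < n) tnth (map_tuple (eval x) ts) i *~ tnth k i.
    rewrite teval_tsum big_map big_enum /=; apply: eq_bigr => i _.
    by rewrite teval_tmulz teval_of_term tnth_map.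
  by split=> -[H ?]; split=> // i; have := H i; rewrite tnth_map.
- exact: pdef_not IH.
- exact: pdef_and IHf IHg.
- exact: pdef_or IHf IHg.
- exact: pdef_imp IHf IHg.
all: pose s u : tm (option nat) := if u == v then TVar None else TVar (Some u).
all: have sE (M : structure) (x : nat -> M) a :
       (fun u => teval (ocons a x) (s u)) = upd x v a
     by apply: functional_extensionality => u; rewrite /s /upd; case: eqP.
- apply: pdef_ext (pdef_ex_left (pdef_sub s id IH)) => M hM x g gU /=.
  by split=> -[a]; rewrite ?sE => H; exists a; rewrite ?sE.
- have dn := pdef_not (pdef_ex_left (pdef_sub s id (pdef_not IH))).
  apply: (pdef_ext _ dn) => M hM x g gU /=.
  split=> [none a|H [a]]; last by rewrite sE; apply; apply: H.
  by apply: NNPP => nfa; apply: none; exists a; rewrite sE.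
Qed.

(** * Traces of polynomial equations on U *)

Lemma qdef_all_elts (I : finType) V
    (P : forall K : closedFieldType, (I + V -> K) -> Prop) :
  qdef P -> qdef (fun K (e : V -> K) => forall l : I -> K, P K (bcat l e)).
Proof.
have ordP n (Q : forall K : closedFieldType, ('I_n + V -> K) -> Prop) :
    qdef Q -> qdef (fun K (e : V -> K) => forall l : 'I_n -> K, Q K (bcat l e)).
  elim: n Q => [|n IH] Q dQ.
    have dQ0 := qdef_sub (fun v : 'I_0 + V => match v with
      inl _ => TZero | inr v => TVar v end) dQ.
    apply: (qdef_ext _ dQ0) => K e; split=> [Q0 l|H].
      by move: Q0; congr (Q K _); apply: functional_extensionality => -[[]|].
    by have := H (fun=> 0); congr (Q K _); apply: functional_extensionality => -[[]|].
  pose s (v : 'I_n.+1 + V) : option ('I_n + V) := match v with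
    inl i => omap inl (unlift ord0 i) | inr v => Some (inr v) end.
  have dQ1 := IH _ (qdef_all_elt (qdef_ren s dQ)).
  apply: (qdef_ext _ dQ1) => K e; split=> H l.
    have := H (fun i => l (lift ord0 i)) (l ord0); congr (Q K _).
    apply: functional_extensionality => -[i|//] /=.
    by case: unliftP => [j ->|->].
  move=> a; have := H (fun i => if unlift ord0 i is Some j then l j else a).
  congr (Q K _); apply: functional_extensionality => -[i|//] /=.
  by case: unliftP.
move=> dP; pose s (v : I + V) : 'I_#|I| + V :=
  match v with inl i => inl (enum_rank i) | inr v => inr v end.
apply: qdef_ext (ordP _ _ (qdef_ren s dP)) => K e; split=> H l.
  have := H (fun i => l (enum_val i)); congr (P K _).
  by apply: functional_extensionality => -[i|//] /=; rewrite enum_rankK.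
have := H (fun i => l (enum_rank i)); congr (P K _).
by apply: functional_extensionality => -[].
Qed.

Definition indep (K : fieldType) (I J : finType) (v : I -> J -> K) : Prop :=
  forall l : I -> K, (forall j, \sum_i l i * v i j = 0) -> forall i, l i = 0.

Lemma indep_card (K : fieldType) (I J : finType) (v : I -> J -> K) :
  indep v -> (#|I| <= #|J|)%N.
Proof.
move=> v_indep.
pose A := \matrix_(i < #|I|, j < #|J|) v (enum_val i) (enum_val j).
suff : row_free A by rewrite -row_leq_rank => /leq_trans; apply; exact: rank_leq_col.
rewrite -kermx_eq0; apply/eqP/row_matrixP => i; rewrite row0.
set u := row i _; have uA : u *m A = 0 by rewrite -row_mul mulmx_ker row0.
apply/rowP=> k; rewrite [RHS]mxE -(enum_valK k).
apply: (v_indep (fun i => u 0 (enum_rank i))) => j.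
have := congr1 (fun B : 'rV_ _ => B 0 (enum_rank j)) uA.
rewrite [LHS]mxE [RHS]mxE => E; rewrite -[RHS]E (reindex (@enum_val I predT)) /=; last first.
  by apply: onW_bij; apply: enum_val_bij.
by apply: eq_bigr => m _; rewrite enum_valK [A _ _]mxE enum_rankK.
Qed.

Lemma indep_sub (K : fieldType) (I I' J : finType) (v : I -> J -> K) (f : I' -> I) :
  injective f -> indep v -> indep (v \o f).
Proof.
move=> f_inj v_indep l lv i'.
pose l' i := \sum_(k | f k == i) l k.
have <- : l' (f i') = l i'.
  by rewrite /l' (big_pred1 i') // => k /=; rewrite inj_eq.
apply: v_indep => j; rewrite -{2}(lv j) [RHS](partition_big f xpredT) //=.
apply: eq_bigr => i _; rewrite mulr_suml; apply: eq_bigr => k /eqP <-.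
by [].
Qed.

(** The quantifier over coefficients in K is eliminated here; what remains are polynomial conditions
    with integer coefficients on the entries. *)
Lemma qdef_indep V (I J : finType) (t : I -> J -> tm V) :
  qdef (fun K (e : V -> K) => indep (fun i j => teval e (t i j))).
Proof.
pose s j : tm (I + V) := tsum [seq TMul (TVar (inl i))
  (tsub (fun v => TVar (inr v)) (t i j)) | i : I].
have ds := qdef_imp (qdef_forall_fin (fun j => qdef_eq0 (s j)))
  (qdef_forall_fin (fun i => qdef_eq0 (TVar (inl i)))).
apply: qdef_ext (qdef_all_elts ds) => K e.
have sE l j : teval (bcat l e) (s j) = \sum_i l i * teval e (t i j).
  rewrite teval_tsum big_map big_enum /=; apply: eq_bigr => i _.
  by rewrite teval_tsub.
by split=> H l ls i; apply: (H l _ i) => j; move: (ls j); rewrite sE.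
Qed.

(** Equal monomials are not collected: each occurrence is a coordinate of its own, which does no
    harm to the linear algebra. With [X] empty the coefficients are closed terms, that is,
    integers. *)
Fixpoint texpand X Y (t : tm (X + Y)) : seq (tm X * seq Y) :=
  match t with
  | TVar (inl v) => [:: (TVar v, [::])]
  | TVar (inr y) => [:: (TOne, [:: y])]
  | TZero => [::]
  | TOne => [:: (TOne, [::])]
  | TAdd t u => texpand t ++ texpand u
  | TOpp t => [seq (TOpp c.1, c.2) | c <- texpand t]
  | TMul t u => [seq (TMul c.1 d.1, c.2 ++ d.2) | c <- texpand t, d <- texpand u]
  end.

Lemma teval_texpand (K : closedFieldType) X Y (x : X -> K) (g : Y -> K) t :
  teval (bcat x g) t = \sum_(c <- texpand t) teval x c.1 * \prod_(y <- c.2) g y.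
Proof.
elim: t => /= [[v|y]|||t -> u ->|t ->|t -> u ->].
- by rewrite big_seq1 big_nil mulr1.
- by rewrite big_seq1 big_seq1 mul1r.
- by rewrite big_nil.
- by rewrite big_seq1 big_nil mulr1.
- by rewrite big_cat.
- by rewrite big_map -sumrN; apply: eq_bigr => c _; rewrite mulNr.
- rewrite big_allpairs_dep big_distrlr /=; apply: eq_bigr => c _; apply: eq_bigr => d _.
  by rewrite big_cat mulrACA.
Qed.

Lemma sum_option (V : nmodType) (I : finType) (F : option I -> V) :
  \sum_o F o = F None + \sum_i F (Some i).
Proof.
rewrite (bigD1 None) //=; congr (_ + _).
rewrite (reindex_omap Some id) => [|[]//]; apply: eq_bigl => i /=.
by rewrite eqxx.
Qed.

Section Traced.
Variable X : Type.

(* In the case j, as soon as [td_p] holds of (x, h), the traced predicate of (x, g) is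
   equivalent to [td_u] of (h, g), where x does not occur. *)
Record trace_data (Y : finType) := TraceData {
  td_case : finType;
  td_pos : td_case -> finType;
  td_neg : td_case -> finType;
  td_p : forall j, forall K : closedFieldType, (X + td_pos j -> K) -> Prop;
  td_n : forall j, forall K : closedFieldType, (X + td_neg j -> K) -> Prop;
  td_u : forall j, forall M : structure, (td_pos j + Y -> M) -> Prop
}.

Definition td_in_neg Y (D : trace_data Y) (M : structure) (x : X -> M) j :=
  forall h : td_neg j -> M, inU_all h -> @td_n Y D j M (bcat x h).

Definition td_in_case Y (D : trace_data Y) (M : structure) (x : X -> M) j :=
  (exists2 h : td_pos j -> M, inU_all h & @td_p Y D j M (bcat x h)) /\
  td_in_neg x j.

Definition traced_by (Y : finType) (P : forall M : structure, (X -> M) -> (Y -> M) -> Prop)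
    (D : trace_data Y) :=
  (forall j : td_case D, [/\ qdef (td_p (j := j)), qdef (td_n (j := j)) &
     pdef (fun M (_ : void -> M) g => @td_u Y D j M g)]) /\
  forall M : structure, ACF_m_Sigma M -> forall x : X -> M,
    (exists! j, td_in_case (D := D) x j) /\
    forall j, td_in_neg (D := D) x j -> forall h, inU_all h ->
      @td_p Y D j M (bcat x h) -> forall g, inU_all g ->
      (P M x g <-> @td_u Y D j M (bcat h g)).

Definition traced Y P := exists D : trace_data Y, traced_by P D.

Lemma traced_not (Y : finType)
    (P : forall M : structure, (X -> M) -> (Y -> M) -> Prop) :
  traced P -> traced (fun M x g => ~ P M x g).
Proof.
move=> [[J H H' p n u] [/= dD DP]].
exists (@TraceData Y J H H' p n (fun j M g => ~ u j M g)); split=> [j|M hM x].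
  by have [dp dn du] := dD j; split=> //; apply: pdef_not.
have [ex1 xP] := DP M hM x; split=> // j nj h hU ph g gU /=.
by have := xP j nj h hU ph g gU; tauto.
Qed.

(** Neither the case nor the family attached to it involves the quantified variables, so the
    quantifier passes directly to [td_u]. *)
Lemma traced_block (Y J : finType)
    (P : forall M : structure, (X -> M) -> (J + Y -> M) -> Prop) :
    traced P ->
  traced (fun M x (g : Y -> M) => exists2 h : J -> M, inU_all h & P M x (bcat h g)).
Proof.
move=> [[C H H' p n u] [/= dD DP]].
pose s j (v : H j + (J + Y)) : J + (H j + Y) := match v with
  | inl h => inr (inl h) | inr (inl i) => inl i | inr (inr y) => inr (inr y) end.
have sE j (M : structure) (h : J -> M) (e : H j -> M) (g : Y -> M) :
    bcat h (bcat e g) \o s j = bcat e (bcat h g).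
  by apply: functional_extensionality => -[|[]].
exists (@TraceData Y C H H' p n (fun j M g =>
  exists2 h : J -> M, inU_all h & u j M (bcat h g \o s j))); split=> [j|M hM x].
  have [dp dn du] := dD j; split=> //.
  by have := pdef_ex (pdef_ren (s j) du).
have [ex1 xP] := DP M hM x; split=> // j nj h hU ph g gU /=.
by split=> -[i iU Pi]; exists i => //; move: Pi; rewrite sE;
  have := xP j nj h hU ph (bcat i g) (inU_bcat iU gU); tauto.
Qed.

(** The cases are pairs of cases, with the two families side by side. Separating the joint negative
    condition into its two halves uses that U is nonempty. *)
Lemma traced_and (Y : finType)
    (P Q : forall M : structure, (X -> M) -> (Y -> M) -> Prop) :
  traced P -> traced Q -> traced (fun M x g => P M x g /\ Q M x g).
Proof.
move=> [[C1 H1 H1' p1 n1 u1] [/= dD1 DP1]] [[C2 H2 H2' p2 n2 u2] [/= dD2 DP2]].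
pose l (A B : Type) (v : X + A) : X + (A + B) :=
  match v with inl v => inl v | inr a => inr (inl a) end.
pose r (A B : Type) (v : X + B) : X + (A + B) :=
  match v with inl v => inl v | inr b => inr (inr b) end.
have lE (A B : Type) (K : Type) (x : X -> K) (h : A + B -> K) :
    bcat x h \o l A B = bcat x (h \o inl).
  by apply: functional_extensionality => -[].
have rE (A B : Type) (K : Type) (x : X -> K) (h : A + B -> K) :
    bcat x h \o r A B = bcat x (h \o inr).
  by apply: functional_extensionality => -[].
pose lu (A B : Type) (v : A + Y) : (A + B) + Y :=
  match v with inl a => inl (inl a) | inr y => inr y end.
pose ru (A B : Type) (v : B + Y) : (A + B) + Y :=
  match v with inl b => inl (inr b) | inr y => inr y end.
have luE (A B : Type) (K : Type) (h : A + B -> K) (g : Y -> K) :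
    bcat h g \o lu A B = bcat (h \o inl) g.
  by apply: functional_extensionality => -[].
have ruE (A B : Type) (K : Type) (h : A + B -> K) (g : Y -> K) :
    bcat h g \o ru A B = bcat (h \o inr) g.
  by apply: functional_extensionality => -[].
exists (@TraceData Y (C1 * C2)%type (fun j => (H1 j.1 + H2 j.2)%type)
  (fun j => (H1' j.1 + H2' j.2)%type)
  (fun j K e => p1 j.1 K (e \o l _ _) /\ p2 j.2 K (e \o r _ _))
  (fun j K e => n1 j.1 K (e \o l _ _) /\ n2 j.2 K (e \o r _ _))
  (fun j M g => u1 j.1 M (g \o lu _ _) /\ u2 j.2 M (g \o ru _ _))).
split=> [[j1 j2]|M hM x] /=.
  have [dp1 dn1 du1] := dD1 j1; have [dp2 dn2 du2] := dD2 j2; split.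
  - exact: qdef_and (qdef_ren _ dp1) (qdef_ren _ dp2).
  - exact: qdef_and (qdef_ren _ dn1) (qdef_ren _ dn2).
  - exact: pdef_and (pdef_ren (lu (H1 j1) (H2 j2)) du1) (pdef_ren (ru (H1 j1) (H2 j2)) du2).
have [ex1 xP1] := DP1 M hM x; have [ex2 xP2] := DP2 M hM x.
rewrite /td_in_case /td_in_neg /= in ex1 xP1 ex2 xP2 *.
have negE j1 j2 : (forall h : H1' j1 + H2' j2 -> M, inU_all h ->
      n1 j1 M (bcat x h \o l _ _) /\ n2 j2 M (bcat x h \o r _ _)) <->
    (forall h, inU_all h -> n1 j1 M (bcat x h)) /\
    (forall h, inU_all h -> n2 j2 M (bcat x h)).
  split=> [nn|[nn1 nn2] h hU]; last first.
    by rewrite lE rE; split; [apply: nn1|apply: nn2] => i; apply: hU.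
  split=> h hU.
    have [h' h'U] := inU_one (H2' j2) hM.
    by have [+ _] := nn _ (inU_bcat hU h'U); rewrite lE.
  have [h' h'U] := inU_one (H1' j1) hM.
  by have [_] := nn _ (inU_bcat h'U hU); rewrite rE.
split=> [|[j1 j2] /negE[nn1 nn2] h hU [ph1 ph2] g gU] /=; last first.
  move: ph1 ph2; rewrite lE rE luE ruE => ph1 ph2.
  have hU1 : inU_all (h \o inl) by move=> i; apply: hU.
  have hU2 : inU_all (h \o inr) by move=> i; apply: hU.
  by rewrite (xP1 j1 nn1 _ hU1 ph1 g gU) (xP2 j2 nn2 _ hU2 ph2 g gU).
have [j1 [[[h1 h1U ph1] nn1] uniq1]] := ex1.
have [j2 [[[h2 h2U ph2] nn2] uniq2]] := ex2.
exists (j1, j2); split=> [|[k1 k2] [[h hU] /=]].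
  split; last exact/negE.
  exists (bcat h1 h2); first exact: inU_bcat.
  by rewrite lE rE.
rewrite lE rE => -[pk1 pk2] /negE[nk1 nk2].
congr (_, _); [apply: uniq1|apply: uniq2]; split=> //.
  by exists (h \o inl) => // i; apply: hU.
by exists (h \o inr) => // i; apply: hU.
Qed.

Lemma traced_ext (Y : finType)
    (P Q : forall M : structure, (X -> M) -> (Y -> M) -> Prop) :
    (forall M : structure, ACF_m_Sigma M -> forall x g, inU_all g ->
       (P M x g <-> Q M x g)) ->
  traced P -> traced Q.
Proof.
move=> PQ [D [dD DP]]; exists D; split=> // M hM x.
have [ex1 xP] := DP M hM x; split=> // j nj h hU ph g gU.
by rewrite -PQ //; apply: xP.
Qed.

(* The vectors (g^mu)_mu of monomials of solutions of p(x, g) = 0 span a subspace of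
   dimension d, where d is the largest size of a linearly independent family
   h of solutions; once such an h is fixed, g is a solution iff its vector depends
   linearly on those of h, a condition from which x has disappeared. *)
Lemma traced_eq0 (Y : finType) (t : tm (X + Y)) :
  traced (fun M x (g : Y -> M) => teval (bcat x g) t = 0).
Proof.
pose L := size (texpand t); pose c (i : 'I_L) := nth (TZero, [::]) (texpand t) i.
pose mono V (r : Y -> V) (i : 'I_L) : tm V :=
  foldr (@TMul V) TOne [seq TVar (r y) | y <- (c i).2].
have monoE (K : closedFieldType) V (r : Y -> V) (e : V -> K) i :
    teval e (mono V r i) = \prod_(y <- (c i).2) e (r y).
  rewrite /mono; elim: (c i).2 => [|y s IH]; first by rewrite big_nil.
  by rewrite big_cons /= IH.
have evalE (K : closedFieldType) (x : X -> K) (g : Y -> K) :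
    teval (bcat x g) t = \sum_i teval x (c i).1 * teval g (mono Y id i).
  rewrite teval_texpand (big_nth (TZero, [::])) big_mkord.
  by apply: eq_bigr => i _; rewrite monoE.
pose ok (I : finType) (K : closedFieldType) (e : X + (I * Y) -> K) :=
  (forall i, teval (bcat (e \o inl) (fun y => e (inr (i, y)))) t = 0) /\
  indep (fun i mu => teval e (mono _ (fun y => inr (i, y)) mu)).
have d_ok I : qdef (@ok I).
  apply: qdef_and; last exact: qdef_indep.
  apply: qdef_forall_fin => i.
  pose s (v : X + Y) : X + (I * Y) :=
    match v with inl v => inl v | inr y => inr (i, y) end.
  apply: qdef_ext (qdef_ren s (qdef_eq0 t)) => K e.
  suff -> : e \o s = bcat (e \o inl) (fun y => e (inr (i, y))) by [].
  by apply: functional_extensionality => -[].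
pose fam (I : finType) (K : closedFieldType) (h : I -> Y -> K) :=
  indep (fun i mu => teval (h i) (mono Y id mu)).
have okE (I : finType) (K : closedFieldType) (x : X -> K) (h : I * Y -> K) :
    ok I K (bcat x h) <-> (forall i, teval (bcat x (fun y => h (i, y))) t = 0) /\
      fam I K (fun i y => h (i, y)).
  have E : (fun i mu => teval (bcat x h) (mono _ (fun y => inr (i, y)) mu)) =
      (fun i mu => teval (fun y => h (i, y)) (mono Y id mu)).
    apply: functional_extensionality => i; apply: functional_extensionality => mu.
    by rewrite !monoE.
  by rewrite /ok /fam E.
pose next d (o : option 'I_d) (y : Y) : 'I_d * Y + Y :=
  if o is Some i then inl (i, y) else inr y.
pose dep d (M : structure) (g : 'I_d * Y + Y -> M) :=
  ~ indep (fun (o : option 'I_d) mu => teval g (mono _ (next d o) mu)).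
have depE d (M : structure) (h : 'I_d * Y -> M) (g : Y -> M) :
    dep d M (bcat h g) <->
    ~ fam (option 'I_d) M (fun o => if o is Some i then fun y => h (i, y) else g).
  have E : (fun (o : option 'I_d) mu => teval (bcat h g) (mono _ (next d o) mu)) =
      (fun o mu => teval (if o is Some i then fun y => h (i, y) else g) (mono Y id mu)).
    apply: functional_extensionality => o; apply: functional_extensionality => mu.
    by rewrite !monoE; case: o.
  by rewrite /dep /fam E.
(* In case [d] there are [d] independent solutions but no d + 1 of them, the larger family being
   indexed by [option 'I_d]. Vectors with [L] coordinates allow for [d] the values 0 to [L]. *)
exists (@TraceData Y 'I_L.+1 (fun d => ('I_d * Y)%type) (fun d => (option 'I_d * Y)%type)
  (fun d K e => ok 'I_d K e) (fun d K e => ~ ok (option 'I_d) K e)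
  (fun d M g => dep d M g)).
split=> [d|M hM x] /=.
  split; [exact: d_ok|exact: (qdef_not (d_ok _))|].
  pose s v : void + ('I_d * Y + Y) := inr v.
  have di := qdef_not (qdef_indep (fun o mu => mono _ (s \o next d o) mu)).
  apply: pdef_ext (pdef_qdef di) => M hM x g gU.
  suff -> : (fun o mu => teval (bcat x g) (mono _ (s \o next d o) mu)) =
    (fun o mu => teval g (mono _ (next d o) mu)) by [].
  apply: functional_extensionality => o; apply: functional_extensionality => mu.
  by rewrite !monoE.
rewrite /td_in_case /td_in_neg /=.
pose has (I : finType) := exists2 h : I * Y -> M, inU_all h & ok I M (bcat x h).
have negE (I : finType) : (forall h : I * Y -> M, inU_all h -> ~ ok I M (bcat x h)) <-> ~ has I.
  by split=> [none [h hU /(none h hU)]//|none h hU hok]; apply: none; exists h.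
have has_sub (I I' : finType) (f : I' -> I) : injective f -> has I -> has I'.
  move=> f_inj [h hU /okE[sol fam_h]]; exists (fun v => h (f v.1, v.2)).
    by move=> v; apply: hU.
  by apply/okE; split=> [i|]; [exact: (sol (f i))|exact: (indep_sub f_inj fam_h)].
have has_le d e : (d <= e)%N -> has 'I_e -> has 'I_d.
  by move=> le_de; apply: (has_sub _ _ (widen_ord le_de)) => i j /(congr1 val) E; apply: val_inj.
have has_optP d : has (option 'I_d) <-> has 'I_d.+1.
  split.
    apply: (has_sub _ _ (unlift ord0)) => i j.
    by case: unliftP => [i' ->|->]; case: unliftP => [j' ->|->] // [->].
  apply: (has_sub _ _ (fun o : option 'I_d => if o is Some i then lift ord0 i else ord0)).
  by move=> [i|] [j|] // /eqP; rewrite ?(inj_eq lift_inj) => /eqP // ->.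
have has_max d : has 'I_d -> (d <= L)%N.
  by move=> [h _ /okE[_ /indep_card]]; rewrite !card_ord.
have has0 : has 'I_0.
  have [h hU] := inU_one ('I_0 * Y) hM.
  by exists h => //; apply/okE; split=> [[]//|l _ []].
split.
  have [d [dL has_d nhas_d]] : exists d, [/\ (d <= L)%N, has 'I_d & ~ has 'I_d.+1].
    apply: NNPP => none; suff /has_max : has 'I_L.+1 by rewrite ltnn.
    elim: L.+1 => // d IH; apply: NNPP => nhas; apply: none; exists d; split=> //.
    exact: has_max.
  rewrite -ltnS in dL; exists (Ordinal dL); split=> [|e [has_e /negE]].
    by split=> //; apply/negE => /has_optP.
  move=> nhas_e; apply: val_inj => /=.
  case: (ltngtP d e) => // lt_de.
    by case: nhas_d; apply: has_le has_e.
  by case: nhas_e; apply/has_optP; apply: has_le has_d.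
(* A solution [g] independent of the family [h] would extend it to d + 1 independent solutions,
   against [none]. *)
move=> d none h hU /okE[sol fam_h] g gU; rewrite depE; split=> [gt fam_hg|dep_g].
  apply: (none (fun v => if v.1 is Some i then h (i, v.2) else g v.2)).
    by move=> [[i|] y] /=; [apply: hU|apply: gU].
  apply/okE; split=> [[i|]|]; [exact: (sol i)|exact: gt|].
  have E : (fun (o : option 'I_d) y => if o is Some i then h (i, y) else g y) =
      (fun o => if o is Some i then fun y => h (i, y) else g).
    by apply: functional_extensionality => -[].
  by move: fam_hg; rewrite -E.
have [l [l_dep l0]] : exists l : option 'I_d -> M,
    (forall mu, \sum_o l o * teval (if o is Some i then fun y => h (i, y) else g)
       (mono Y id mu) = 0) /\ ~ forall o, l o = 0.
  apply: NNPP => nex; apply: dep_g => l l_dep o; apply: NNPP => lo; apply: nex.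
  by exists l; split=> // l0; apply: lo.
(* With coefficient 0 at [g], the relation would be one among the members of [h], which are
   independent. *)
have lN : l None != 0.
  apply: contra_notN l0 => /eqP lN0 [i|//].
  apply: (fam_h (fun i => l (Some i))) => mu.
  by rewrite -[RHS](l_dep mu) sum_option lN0 mul0r add0r.
apply: (mulfI lN); rewrite mulr0 evalE mulr_sumr.

(* The equation is linear in the vector of monomials: [l None] times its value at [g] is a
   combination of its values at the members of [h], which are solutions. *)
have -> : \sum_i l None * (teval x (c i).1 * teval g (mono Y id i)) =
    - \sum_i l (Some i) * teval (bcat x (fun y => h (i, y))) t.
  under [in RHS]eq_bigr => i _ do rewrite evalE mulr_sumr.
  rewrite exchange_big -sumrN; apply: eq_bigr => mu _.
  have := l_dep mu; rewrite sum_option => /eqP; rewrite addr_eq0 => /eqP E.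
  rewrite mulrCA E mulrN mulr_sumr; congr (- _); apply: eq_bigr => i _.
  by rewrite mulrCA.
by rewrite big1 ?oppr0 // => i _; rewrite sol mulr0.
Qed.
End Traced.

Lemma traced_pf X (Y : finType) (f : pf X Y) :
  traced (fun M (x : X -> M) (g : Y -> M) => psat x g f).
Proof.
elim: f => [{}Y m|{}Y J f IH|{}Y J f IH] /=.
- elim: m => [t|m IH|m IHm n IHn] /=.
  + by apply: traced_ext (traced_eq0 t) => M hM x g gU; split=> /eqP.
  + by apply: traced_ext (traced_not IH) => M hM x g gU; split=> /negP.
  + by apply: traced_ext (traced_and IHm IHn) => M hM x g gU; split=> /andP.
- exact: (traced_block IH).
- apply: traced_ext (traced_not (traced_block (traced_not IH))) => M hM x g gU.
  split=> [none h hU|H [h hU]]; last by apply; apply: H.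
  by apply: NNPP => nf; apply: none; exists h.
Qed.

(** * Controlled formulas *)

Section HoldsU.
Variable M : structure.
Implicit Types e : nat -> M.

Lemma holds_ext (f : formula) e e' :
  (forall v, v \in free_vars f -> e v = e' v) -> holds e f <-> holds e' f.
Proof.
have evalE t e1 e2 : (forall v, v \in term_vars t -> e1 v = e2 v) ->
    eval e1 t = eval e2 t.
  elim: t => [v|||s IHs t IHt|t IHt|s IHs t IHt] //= E.
  - by apply: E; rewrite inE.
  - by rewrite IHs ?IHt // => v vs; apply: E; rewrite mem_cat vs ?orbT.
  - by rewrite IHt.
  - by rewrite IHs ?IHt // => v vs; apply: E; rewrite mem_cat vs ?orbT.
have updE v a g e1 e2 : (forall u, u \in [seq w <- free_vars g | w != v] -> e1 u = e2 u) ->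
    forall u, u \in free_vars g -> upd e1 v a u = upd e2 v a u.
  move=> E u ug; rewrite /upd; case: (eqVneq u v) => // uv.
  by apply: E; rewrite mem_filter uv.
elim: f e e' => [s t|t|n k ts|f IH|f IHf g IHg|f IHf g IHg|f IHf g IHg|v f IH|v f IH]
    e e' /= E.
- by rewrite (evalE s e e') ?(evalE t e e') // => v vs; apply: E; rewrite mem_cat vs ?orbT.
- by rewrite (evalE t e e').
- suff -> : map_tuple (eval e) ts = map_tuple (eval e') ts by [].
  apply: eq_from_tnth => i; rewrite !tnth_map; apply: evalE => v vs; apply: E.
  apply/flattenP; exists (term_vars (tnth ts i)) => //.
  by rewrite -(tnth_map term_vars ts i) (mem_tnth i (map_tuple term_vars ts)).
- by rewrite (IH e e').
1-3: by rewrite (IHf e e') ?(IHg e e') // => v vs; apply: E; rewrite mem_cat vs ?orbT.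
- by split=> -[a H]; exists a; apply/(IH _ _ (updE v a f e e' E)).
- by split=> H a; apply/(IH _ _ (updE v a f e e' E)).
Qed.

Lemma U_variant_cons y ys e a e' : U_interp a ->
  U_variant ys (upd e y a) e' -> U_variant (y :: ys) e e'.
Proof.
move=> Ua [eq_e' Ue']; split=> v; rewrite inE.
  by rewrite negb_or => /andP[/negbTE vy vys]; rewrite eq_e' // /upd vy.
case: (boolP (v \in ys)) => [/Ue' //|vys]; rewrite orbF => /eqP vy.
by rewrite eq_e' // /upd vy eqxx.
Qed.

Lemma U_variant_head y ys e e' :
  U_variant (y :: ys) e e' -> U_interp (e' y) /\ U_variant ys (upd e y (e' y)) e'.
Proof.
move=> [eq_e' Ue']; split; first by apply: Ue'; rewrite mem_head.
split=> v vys; last by apply: Ue'; rewrite inE vys orbT.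
rewrite /upd; case: (eqVneq v y) => [-> //|vy].
by rewrite eq_e' // inE negb_or vy.
Qed.

Lemma holds_exU ys f e :
  holds e (exU ys f) <-> exists2 e', U_variant ys e e' & holds e' f.
Proof.
elim: ys e => [|y ys IH] e /=.
  split=> [fe|[e' [eq_e' _]]]; first by exists e.
  by have -> : e' = e by apply: functional_extensionality => v; apply: eq_e'.
split=> [[a []]|[e' /U_variant_head[Ue' var_e'] fe']].
  rewrite /upd eqxx => Ua /IH[e' var_e' fe']; exists e' => //.
  exact: U_variant_cons var_e'.
by exists (e' y); rewrite /upd eqxx; split=> //; apply/IH; exists e'.
Qed.

Lemma holds_allU ys f e :
  holds e (allU ys f) <-> forall e', U_variant ys e e' -> holds e' f.
Proof.
elim: ys e => [|y ys IH] e /=.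
  split=> [fe e' [eq_e' _]|]; last by apply; split.
  by have -> : e' = e by apply: functional_extensionality => v; apply: eq_e'.
split=> [H e' /U_variant_head[Ue' var_e']|H a].
  by have := H (e' y); rewrite {1}/upd eqxx => /(_ Ue')/IH; apply.
rewrite {1}/upd eqxx => Ua; apply/IH => e' var_e'; apply: H.
exact: U_variant_cons var_e'.
Qed.

Definition assign (J : finType) (nm : J -> nat) (h : J -> M) e v :=
  if [pick j | nm j == v] is Some j then h j else e v.

Lemma assign_nm (J : finType) (nm : J -> nat) h e :
  injective nm -> assign nm h e \o nm = h.
Proof.
move=> nm_inj; apply: functional_extensionality => j; rewrite /= /assign.
by case: pickP => [i /eqP/nm_inj -> //|/(_ j)]; rewrite eqxx.
Qed.

Lemma U_variant_assign (J : finType) (nm : J -> nat) h e :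
  inU_all h -> U_variant [seq nm j | j : J] e (assign nm h e).
Proof.
move=> hU; split=> v; rewrite /assign.
  by case: pickP => // j /eqP <- /negP[]; apply: map_f; rewrite mem_enum.
case: pickP => [j _ _|none /mapP[j _ vj]]; first exact: hU.
by have := none j; rewrite vj eqxx.
Qed.

Lemma U_variant_nm (J : finType) (nm : J -> nat) e e' :
  U_variant [seq nm j | j : J] e e' -> inU_all (e' \o nm).
Proof. by move=> [_ Ue'] j; apply: Ue'; apply: map_f; rewrite mem_enum. Qed.

Lemma holds_big_Or (J : finType) (F : J -> formula) e :
  holds e (\big[Or/False_]_(j : J) F j) <-> exists j, holds e (F j).
Proof.
suff H (r : seq J) : holds e (\big[Or/False_]_(j <- r) F j) <->
    exists2 j, j \in r & holds e (F j).
  by rewrite H; split=> [[j _ Fj]|[j Fj]]; exists j; rewrite ?mem_index_enum.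
elim: r => [|i r IH]; first by rewrite big_nil; split=> [[]|[]].
rewrite big_cons /= IH; split=> [[Fi|[j jr Fj]]|[j]].
- by exists i; rewrite ?mem_head.
- by exists j; rewrite // inE jr orbT.
- by rewrite inE => /orP[/eqP -> Fi|jr Fj]; [left|right; exists j].
Qed.

End HoldsU.

(** * From formulas quantified over U to U-formulas *)

Lemma rmorph_teval (R S : nzRingType) V (f : {rmorphism R -> S}) (e : V -> R) t :
  f (teval e t) = teval (f \o e) t.
Proof.
elim: t => [v|||s IHs t IHt|t IHt|s IHs t IHt] //=.
- exact: rmorph0.
- exact: rmorph1.
- by rewrite rmorphD IHs IHt.
- by rewrite rmorphN IHt.
- by rewrite rmorphM IHs IHt.
Qed.

Lemma inU_prod (M : structure) I (s : seq I) (h : I -> M) :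
  ACF_m_Sigma M -> inU_all h -> U_interp (\prod_(i <- s) h i).
Proof.
move=> [[_ U1 UM _] _ _] hU; elim: s => [|i s IH]; first by rewrite big_nil.
by rewrite big_cons; apply: UM.
Qed.

Definition U_definable (Y : finType) (nm : Y -> nat) (P : forall M : structure, (Y -> M) -> Prop) :=
  exists psi, [/\ U_formula psi, {subset free_vars psi <= codom nm} &
    forall M : structure, ACF_m_Sigma M -> forall e : nat -> M, inU_all (e \o nm) ->
      (holds e psi <-> P M (e \o nm))].

(* Over U, a polynomial equation with integer coefficients is an instance of
   some Sigma: the monomials take their values in U. *)
Lemma U_definable_eq0 (Y : finType) (nm : Y -> nat) (t : tm (void + Y)) :
  U_definable nm (fun M g => teval (bcat (of_void M) g) t = 0).
Proof.
pose s := texpand t; pose n := size s.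
pose mono (c : tm void * seq Y) := foldr Mul One [seq Var (nm y) | y <- c.2].
(* Without field variables the coefficients are closed terms; their values are computed in the
   integers, once for all models. *)
pose k := [tuple teval (of_void int) (tnth (in_tuple s) i).1 | i < n].
pose ts := [tuple mono (tnth (in_tuple s) i) | i < n].
exists (Sigma k ts); split.
- apply: U_Sigma; apply/all_tnthP => i; rewrite tnth_mktuple /mono.
  by elim: (_.2).
- move=> v /flattenP[_ /(tnthP (map_tuple term_vars ts))[i ->]].
  rewrite tnth_map tnth_mktuple /mono; elim: (_.2) => //= y ys IH; rewrite inE => /orP[/eqP ->|//].
  exact: codom_f.
move=> M hM e eU; have [_ _ sigM] := hM.
have monoE c : eval e (mono c) = \prod_(y <- c.2) (e \o nm) y.
  rewrite /mono; elim: c.2 => [|y ys IH]; first by rewrite big_nil.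
  by rewrite big_cons /= IH.
rewrite /= sigM teval_texpand.
have -> : \sum_(i < n) tnth (map_tuple (eval e) ts) i *~ tnth k i =
    \sum_(c <- texpand t) teval (of_void M) c.1 * \prod_(y <- c.2) (e \o nm) y.
  rewrite -/s (big_tnth _ _ s); apply: eq_bigr => i _.
  rewrite tnth_map !tnth_mktuple monoE -mulrzl (rmorph_teval (intmul 1)).
  by congr (teval _ _ * _); apply: functional_extensionality => -[].
split=> [[]//|E]; split=> // i.
by rewrite tnth_map tnth_mktuple monoE; apply: inU_prod.
Qed.

Lemma U_formula_exU ys f : U_formula f -> U_formula (exU ys f).
Proof. by move=> Uf; elim: ys => //= y ys IH; apply: U_exU. Qed.

Lemma free_vars_exU ys f :
  free_vars (exU ys f) =i [predD free_vars f & ys].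
Proof.
elim: ys => //= y ys IH v.
by rewrite eqxx /= mem_filter IH !inE negb_or andbA.
Qed.

Lemma U_definable_not (Y : finType) (nm : Y -> nat)
    (P : forall M : structure, (Y -> M) -> Prop) :
  U_definable nm P -> U_definable nm (fun M g => ~ P M g).
Proof.
move=> [psi [Upsi fv_psi psiP]]; exists (Not psi); split=> //; first exact: U_Not.
by move=> M hM e eU /=; rewrite psiP.
Qed.

(** Names from [b] upwards are fresh as soon as [b] bounds the names in use. *)
Definition block_name (J Y : finType) (nm : Y -> nat) b (v : J + Y) : nat :=
  match v with inl j => b + enum_rank j | inr y => nm y end.

Lemma U_definable_ex (J Y : finType) (nm : Y -> nat) b
    (P : forall M : structure, (J + Y -> M) -> Prop) :
    (forall y, nm y < b)%N -> U_definable (block_name nm b) P ->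
  U_definable nm (fun M g => exists2 h : J -> M, inU_all h & P M (bcat h g)).
Proof.
move=> nm_b [psi [Upsi fv_psi psiP]].
pose nmJ (j : J) := (b + enum_rank j)%N.
have nmJ_inj : injective nmJ by move=> i j /addnI/val_inj/enum_rank_inj.
exists (exU [seq nmJ j | j : J] psi); split.
- exact: U_formula_exU.
- move=> v; rewrite free_vars_exU inE => /andP[vJ /fv_psi/codomP[[j|y] def_v]].
    by case/mapP: vJ; exists j; rewrite ?mem_enum.
  by rewrite def_v; apply: codom_f.
move=> M hM e eU; rewrite holds_exU.
have nmE e' : U_variant [seq nmJ j | j : J] e e' ->
    e' \o block_name nm b = bcat (e' \o nmJ) (e \o nm).
  move=> [eq_e' _]; apply: functional_extensionality => -[//|y] /=.
  apply: eq_e'; apply/mapP => -[j _ nm_y]; have := nm_b y.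
  by rewrite nm_y ltnNge leq_addr.
split=> [[e' var_e' psi_e']|[h hU Ph]].
  have hU := U_variant_nm var_e'; exists (e' \o nmJ) => //.
  rewrite -(nmE e' var_e') -psiP // (nmE e' var_e'); exact: inU_bcat.
have var_e' := U_variant_assign nmJ e hU; exists (assign nmJ h e) => //.
by rewrite psiP // (nmE _ var_e') assign_nm //; apply: inU_bcat.
Qed.

Lemma U_definable_pf (Y : finType) (nm : Y -> nat) b (f : pf void Y) :
  (forall y, nm y < b)%N -> U_definable nm (fun M g => psat (of_void M) g f).
Proof.
have ext (Z : finType) (nmZ : Z -> nat) (P Q : forall M : structure, (Z -> M) -> Prop) :
    (forall M g, P M g <-> Q M g) -> U_definable nmZ P -> U_definable nmZ Q.
  move=> PQ [psi [Upsi fv_psi psiP]]; exists psi; split=> // M hM e eU.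
  by rewrite psiP.
have bound (J Z : finType) (nmZ : Z -> nat) c : (forall z, nmZ z < c)%N ->
    forall v, (block_name (J := J) nmZ c v < c + #|J|)%N.
  move=> nm_c [j|z] /=; first by rewrite ltn_add2l.
  exact: leq_trans (nm_c z) (leq_addr _ _).
elim: f nm b => [{}Y m|{}Y J f IH|{}Y J f IH] nm b nm_b /=.
- elim: m => [t|m IH|m [p [Up fv_p pP]] n [q [Uq fv_q qP]]] /=.
  + by apply: ext (U_definable_eq0 nm t) => M g; split=> /eqP.
  + by apply: ext (U_definable_not IH) => M g; split=> /negP.
  + exists (And p q); split; first exact: U_And.
      by move=> v /=; rewrite mem_cat => /orP[/fv_p|/fv_q].
    by move=> M hM e eU /=; rewrite pP ?qP //; split=> /andP.
- exact: U_definable_ex nm_b (IH _ _ (bound _ _ _ _ nm_b)).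
- have dn := U_definable_not (U_definable_ex nm_b
    (U_definable_not (IH _ _ (bound J _ _ _ nm_b)))).
  apply: ext dn => M g.
  split=> [none h hU|H [h hU]]; last by apply; apply: H.
  by apply: NNPP => nf; apply: none; exists h.
Qed.

(** Once the variables are named, the trace data of the translated formula form a controlled
    formula: [td_p], [td_n] and [td_u] provide [etap], [etan] and [psi]. *)
Theorem theorem3p11 (xs : seq nat) (phi : formula)
  (xs_uniq : uniq xs) (phi_xs : {subset free_vars phi <= xs}) :
  exists theta : formula,
    controlled xs [::] theta /\ ACF_proves (Iff phi theta).
Proof.
have [f fP] := pdef_formula phi.
have [[J H H' p n u] [/= dD DP]] := traced_pf f.
rewrite /td_in_case /td_in_neg /= in DP.
have [b xs_b] : exists b, forall v, v \in xs -> (v < b)%N.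
  exists (\max_(v <- xs) v).+1 => v vxs.
  by rewrite ltnS (big_rem v) //= leq_maxl.
pose nm (I : finType) (i : I) := (b + enum_rank i)%N.
pose names (I : finType) := [seq nm I i | i : I].
have nm_inj (I : finType) : injective (nm I).
  by move=> i k /addnI/val_inj/enum_rank_inj.
have names_xs (I : finType) v : v \in xs -> v \notin names I.
  move=> /xs_b; rewrite ltnNge; apply: contraNN => /mapP[i _ ->].
  exact: leq_addr.
(* The translated formula has every natural number as a field variable. Values outside [xs] are
   reset to 0, so that the formulas mention only [xs] and the variables of U, named from [b] on, do
   not affect the point. *)
pose x0 (M : structure) (e : nat -> M) v := if v \in xs then e v else 0.
have x0E (M : structure) (I : finType) (e e' : nat -> M) :
    U_variant (names I) e e' -> x0 M e' = x0 M e.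
  move=> [eq_e' _]; apply: functional_extensionality => v; rewrite /x0.
  by case: ifP => // /(names_xs I)/eq_e'.
pose tr (I : finType) (v : nat + I) : term :=
  match v with inl v => if v \in xs then Var v else Zero | inr i => Var (nm I i) end.
have trE (M : structure) (I : finType) (e : nat -> M) :
    (fun v => eval e (tr I v)) = bcat (x0 M e) (e \o nm I).
  by apply: functional_extensionality => -[v|i] //=; rewrite /x0; case: ifP.
have qdefE (I : finType) (P : forall K : closedFieldType, (nat + I -> K) -> Prop) :
    qdef P -> exists g, split_formula xs (names I) g /\
      forall (M : structure) (e : nat -> M),
        holds e g <-> P M (bcat (x0 M e) (e \o nm I)).
  move=> [q qP]; exists (qf_formula (tr I) q); split=> [|M e].
    apply: split_L; first exact: L_qf_formula.
    apply: free_vars_qf_formula => -[v|i] w /=.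
      by case: ifP => // vxs; rewrite inE mem_cat => /eqP ->; rewrite vxs.
    rewrite inE mem_cat => /eqP ->; rewrite orbC map_f ?mem_enum //.
  by rewrite holds_qf_formula trE qP.
have ex_etap j := qdefE _ _ (let: And3 dp _ _ := dD j in dp).
have [etap etapP] := fin_all_exists ex_etap.
have ex_etan j := qdefE _ _ (let: And3 _ dn _ := dD j in dn).
have [etan etanP] := fin_all_exists ex_etan.
have ex_psi j : exists g, split_formula xs (names (H j)) g /\
    forall (M : structure), ACF_m_Sigma M -> forall e : nat -> M, inU_all (e \o nm (H j)) ->
      (holds e g <-> u j M (bcat (e \o nm (H j)) (of_void M))).
  have [_ _ [w wP]] := dD j.
  pose nmv (v : H j + void) := match v with inl h => nm (H j) h | inr v => of_void nat v end.
  have [|g [Ug fv_g gP]] := @U_definable_pf _ nmv (b + #|H j|)%N w.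
    by move=> [h|[]] /=; rewrite ltn_add2l.
  exists g; split=> [|M hM e eU].
    apply: split_U => // v /fv_g/codomP[[h|[]] ->] /=.
    by rewrite map_f ?mem_enum.
  have eE : e \o nmv = bcat (e \o nm (H j)) (of_void M).
    by apply: functional_extensionality => -[|[]].
  have eU' : inU_all (e \o nmv) by rewrite eE; apply: inU_bcat => // -[].
  by rewrite gP // wP // eE.
have [psi psiP] := fin_all_exists ex_psi.
have case_negE j (M : structure) (e : nat -> M) :
    (forall e', U_variant (names (H' j)) e e' -> holds e' (etan j)) <->
    (forall h, inU_all h -> n j M (bcat (x0 M e) h)).
  have [_ etanE] := etanP j.
  split=> [all_n h hU|all_n e' var_e']; last first.
    by apply/etanE; rewrite (x0E _ _ _ _ var_e'); apply/all_n/(U_variant_nm var_e').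
  have var_e' := U_variant_assign (nm (H' j)) e hU.
  by have /etanE := all_n _ var_e'; rewrite (x0E _ _ _ _ var_e') assign_nm.
have case_posE j (M : structure) (e : nat -> M) :
    (exists2 e', U_variant (names (H j)) e e' & holds e' (etap j)) <->
    (exists2 h, inU_all h & p j M (bcat (x0 M e) h)).
  have [_ etapE] := etapP j.
  split=> [[e' var_e' /etapE]|[h hU ph]].
    rewrite (x0E _ _ _ _ var_e') => pe'.
    by exists (e' \o nm (H j)) => //; apply: U_variant_nm var_e'.
  have var_e' := U_variant_assign (nm (H j)) e hU.
  by exists (assign (nm (H j)) h e) => //; apply/etapE;
    rewrite (x0E _ _ _ _ var_e') assign_nm.
(* At every witness of the case, [psi j] is equivalent to one statement in which the witness does
   not occur. Both rigidity and the final equivalence follow from this. *)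
have psiE j (M : structure) (hM : ACF_m_Sigma M) (e e' : nat -> M) :
    (forall h, inU_all h -> n j M (bcat (x0 M e) h)) ->
    U_variant (names (H j)) e e' -> holds e' (etap j) ->
    (holds e' (psi j) <-> psat (x0 M e) (of_void M) f).
  move=> nj var_e' /(proj2 (etapP j)); rewrite (x0E _ _ _ _ var_e') => pe'.
  have e'U := U_variant_nm var_e'.
  have [_ DPx] := DP M hM (x0 M e).
  have [_ ->] := psiP j; rewrite // -(DPx j nj _ e'U pe') //; by case.
have phiE (M : structure) (hM : ACF_m_Sigma M) (e : nat -> M) :
    holds e phi <-> psat (x0 M e) (of_void M) f.
  have vU : inU_all (of_void M) by case.
  rewrite (fP M hM (x0 M e) _ vU).
  by apply: holds_ext => v /phi_xs vxs; rewrite /x0 vxs.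
exists (oplus (fun j => names (H j)) (fun j => names (H' j)) etap etan psi).
split.
  exists J, (fun j => names (H j)), (fun j => names (H' j)), etap, etan, psi; split=> //.
  - have uniq_names (I : finType) : uniq (xs ++ [::] ++ names I).
      rewrite cat_uniq xs_uniq /= map_inj_uniq ?enum_uniq ?andbT; last exact: nm_inj.
      by apply/hasPn => v vI; apply/negP => /(names_xs I); rewrite vI.
    split=> [j|M hM e]; first by have [? _] := etapP j; have [? _] := etanP j.
    have [[j [case_j uniq_j]] _] := DP M hM (x0 M e).
    have caseE k : holds e (in_case (names (H k)) (names (H' k)) (etap k) (etan k)) <->
        (exists2 h, inU_all h & p k M (bcat (x0 M e) h)) /\
        (forall h, inU_all h -> n k M (bcat (x0 M e) h)).
      by rewrite /= holds_exU holds_allU case_posE case_negE.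
    by exists j; split=> [|k /caseE/uniq_j]; first exact/caseE.
  - by move=> j; have [] := psiP j.
  - move=> j M hM e [_ /holds_allU/case_negE nj] e1 e2 var1 var2 p1 p2.
    by rewrite (psiE j M hM e e1) // (psiE j M hM e e2).
move=> M hM e; rewrite /= /oplus holds_big_Or phiE //.
have [[j [[pos_j neg_j] _]] _] := DP M hM (x0 M e).
split=> [fe|[k /holds_exU[e' var_e' [/= pe' [/holds_allU/case_negE nk psi_e']]]]].
  have [e' var_e' pe'] : exists2 e', U_variant (names (H j)) e e' & holds e' (etap j).
    exact/case_posE.
  exists j; apply/holds_exU; exists e' => //=; split=> //; split.
    by apply/holds_allU/case_negE; rewrite (x0E _ _ _ _ var_e').
  exact/(psiE j M hM e e').
by apply/(psiE k M hM e e') => //; rewrite -(x0E _ _ _ _ var_e').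
Qed.
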